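(* Let $\vartheta>0$ be a constant, $\theta=\vartheta/(1+\vartheta)$, and let $g(\delta)=\vartheta^{w(\delta)}$, where $w(\delta)$ is the number of cycles in the permutation divisor $\delta$. For $n\in\mathbb N$ and $\sigma\in\mathbb S_n$ let $$X_n(t)=X_n(\sigma,t)=\frac{1}{f(\sigma)}\sum_{\substack{\delta\mid\sigma\\ |\delta|\le tn}} g(\delta),\quad 0\le t\le 1,\qquad f(\sigma)=\sum_{\delta\mid\sigma}g(\delta).$$ Then for every $0\le t\le 1$, $$\lim_{n\to\infty}\mathbf E_n\big(X_n(t)^2\big)=\begin{cases} I(t,1-\theta) & \text{if } 0\le t\le 1/2,\\ I(1-t,\theta)+2B(t;\theta,1-\theta)-1 & \text{if } 1/2<t\le 1,\end{cases}$$ where, for $0\le t\le 1/2$, $0<a<1$ and $b=1-a$, $$I(t,a)=\frac{2}{\Gamma(a^2)\Gamma(b^2)\Gamma^2(ab)}\int_0^t\frac{\mathrm dw}{w^{1-ab}}\int_0^{t-w}\frac{\mathrm dv}{v^{1-b^2}}\int_0^w\frac{u^{ab-1}\,\mathrm du}{(1-w-v-u)^{1-a^2}},$$ and, for $0\le t\le 1$ and $0<a,b<1$, $B(t;a,b)$ is the beta distribution function $$B(t;a,b)=\frac{\Gamma(a+b)}{\Gamma(a)\Gamma(b)}\int_0^t\frac{\mathrm dv}{v^{1-a}(1-v)^{1-b}}.$$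
   Context: Every permutation $\sigma\in\mathbb S_n$ of $\{1,\dots,n\}$ decomposes uniquely into a set of disjoint cycles (fixed points count as cycles of length 1). A divisor $\delta$ of $\sigma$, written $\delta\mid\sigma$, is any subset (including the empty one) of this set of cycles. Its number of cycles is $w(\delta)$, and its size $|\delta|$ is the sum of the lengths of its cycles. $\mathbf E_n$ is the expectation with respect to the uniform probability measure on the symmetric group $\mathbb S_n$. *)

(* Defs.v *)
From HB Require Import structures.
From mathcomp Require Import all_boot all_order all_algebra all_fingroup.
From mathcomp Require Import all_classical all_reals all_analysis.

Set Implicit Arguments.
Unset Strict Implicit.
Unset Printing Implicit Defensive.

Import Order.TTheory GRing.Theory Num.Theory.
Import numFieldNormedType.Exports.

Local Open Scope classical_set_scope.
Local Open Scope ring_scope.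

(* Permutations of {1, ..., n} are elements of 'S_n. A cycle of s is represented
   by its support, i.e. by its orbit in [porbits s]; fixed points give singleton
   orbits. Since s determines each of its cycles from the support, a divisor of
   s is a subset of [porbits s]. *)
Definition divisor (n : nat) (d : {set {set 'I_n}}) (s : 'S_n) : bool :=
  d \subset porbits s.

Definition ncycles (n : nat) (d : {set {set 'I_n}}) : nat := #|d|.

Definition divisor_size (n : nat) (d : {set {set 'I_n}}) : nat :=
  (\sum_(c in d) #|c|)%N.

Definition divisor_weight (R : realType) (vtheta : R) (n : nat)
    (d : {set {set 'I_n}}) : R :=
  vtheta ^+ ncycles d.

Definition weight_sum (R : realType) (vtheta : R) (n : nat) (s : 'S_n) : R :=
  \sum_(d : {set {set 'I_n}} | divisor d s) divisor_weight vtheta d.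

Definition divisor_process (R : realType) (vtheta : R) (n : nat) (s : 'S_n)
    (t : R) : R :=
  (weight_sum vtheta s)^-1 *
  \sum_(d : {set {set 'I_n}} | divisor d s && ((divisor_size d)%:R <= t * n%:R))
     divisor_weight vtheta d.

(* Expectation for the uniform probability measure on 'S_n. *)
Definition perm_expectation (R : realType) (n : nat) (Y : 'S_n -> R) : R :=
  (\sum_(s : 'S_n) Y s) / #|{: 'S_n}|%:R.

(* Euler's integral; only used at positive arguments. *)
Definition Gamma (R : realType) (a : R) : R :=
  \int[lebesgue_measure]_(x in `]0, +oo[) (x `^ (a - 1) * expR (- x)).

(* In the next two definitions the integrands may blow up at endpoints, where
   the formal value (0 `^ e is 0 for e != 0, and 0^-1 = 0) is irrelevant because
   only a null set is concerned. *)
Definition beta_df (R : realType) (t a b : R) : R :=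
  Gamma (a + b) / (Gamma a * Gamma b) *
  \int[lebesgue_measure]_(v in `[0, t])
     (v `^ (1 - a) * (1 - v) `^ (1 - b))^-1.

(* Intended for 0 <= t <= 1/2 and 0 < a < 1; then w, v, u and 1 - w - v - u are
   all nonnegative on the domain of integration. *)
Definition Ifun (R : realType) (t a : R) : R :=
  let b := 1 - a in
  2 / (Gamma (a ^+ 2) * Gamma (b ^+ 2) * Gamma (a * b) ^+ 2) *
  \int[lebesgue_measure]_(w in `[0, t])
    ((w `^ (1 - a * b))^-1 *
     \int[lebesgue_measure]_(v in `[0, t - w])
       ((v `^ (1 - b ^+ 2))^-1 *
        \int[lebesgue_measure]_(u in `[0, w])
          (u `^ (a * b - 1) / (1 - w - v - u) `^ (1 - a ^+ 2)))).

(* Main.v *)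
Require Import Defs.
From mathcomp Require Import all_boot all_order all_algebra all_fingroup.
From mathcomp Require Import all_classical all_reals all_analysis.
From mathcomp Require Import measurable_realfun ring lra zify.

(* Keeping each cycle of a uniform random permutation independently with
   probability theta, X_n(t)^2 has the same expectation as the indicator that two
   independent such divisors both have size at most tn. The numbers of points in
   both, only the first, only the second or neither of them follow exactly a
   Dirichlet-multinomial law with parameters theta^2, theta(1-theta),
   theta(1-theta), (1-theta)^2: for a fixed 4-colouring, the weighted number of
   colour-preserving permutations is a product of rising factorials, as one sees
   by inserting the points one at a time.
   Log-convexity of Gamma gives (a)_k / k! ~ k^(a-1) / Gamma(a), and the triple sum
   becomes the iterated integral by applying dominated convergence to one sum
   after the other; the Vandermonde convolution bounds the innermost sum
   uniformly, up to t = 1/2. For t > 1/2 one uses inclusion-exclusion and passes to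
   the complementary divisors, which exchanges theta and 1 - theta. *)

Set Implicit Arguments.
Unset Strict Implicit.
Unset Printing Implicit Defensive.

Import Order.TTheory GRing.Theory Num.Theory.
Import numFieldNormedType.Exports.

Local Open Scope ring_scope.

(** * Inserting a point into a permutation *)

(** With a = 1 - theta and b = theta, the parameters a^2, b^2, ab, ab in I(t, 1 - theta) belong to
    the points in neither, in both and in exactly one of the two divisors. They add up to 1, which
    is why all powers of n cancel in the limit. The obstacle is the end t = 1/2. There the domain of
    I reaches the singularity 1 - w - v - u = 0, at w = u = 1/2 and v = 0, so the last factor of the
    triple sum has no bound that is uniform in n. Taking the limits one sum at a time avoids this:
    for fixed w, v inside the domain the innermost sum stays away from the singularity, and the
    outer two limits only need that the innermost sum as a whole is bounded. *)

Section Porbit.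
Variable T : finType.
Implicit Types (s u : {perm T}) (S : {set T}) (x y z j : T).

Lemma perm_porbit s x y : y \in porbit s x -> s y \in porbit s x.
Proof. by case/porbitP=> i ->; rewrite -permM -expgSr mem_porbit. Qed.

Lemma porbit_sub s S x :
  (forall y, y \in S -> s y \in S) -> x \in S -> porbit s x \subset S.
Proof.
move=> stS xS; apply/fintype.subsetP => y /porbitP[i ->].
by elim: i => [|i IHi]; rewrite ?perm1// expgSr permM stS.
Qed.

Lemma porbit_fixed s z : s z = z -> porbit s z = [set z]%SET.
Proof.
move=> sz; apply/eqP; rewrite finset.eqEsubset finset.sub1set porbit_id andbT.
apply: porbit_sub => [y|]; last exact: finset.set11.
by rewrite !finset.in_set1 => /eqP ->; rewrite sz.
Qed.

(** Permutations compose from left to right, so [tperm z j * s] maps j to z and z to [s j]: the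
    fixed point z lands between j and [s j]. *)
Lemma porbit_tpermM s z j x : s z = z -> j != z -> x != z ->
  porbit (tperm z j * s)%g x =
  if j \in porbit s x then (z |: porbit s x)%SET else porbit s x.
Proof.
move=> sz jz xz; set u := (tperm z j * s)%g.
have uz : u z = s j by rewrite permM tpermL.
have uj : u j = z by rewrite permM tpermR.
have uE y : y != z -> y != j -> u y = s y.
  by move=> yz yj; rewrite permM tpermD // eq_sym.
have zO : z \notin porbit s x.
  by rewrite porbit_sym porbit_fixed // finset.in_set1.
have sub : porbit s x \subset porbit u x.
  have : porbit s x \subset (porbit u x :\ z)%SET.
    apply: porbit_sub; last by rewrite finset.in_setD1 xz porbit_id.
    move=> y; rewrite !finset.in_setD1 => /andP[yz yu].
    rewrite -[X in s y != X]sz (inj_eq perm_inj) yz /=.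
    have [yj|yj] := eqVneq y j; last by rewrite -uE // perm_porbit.
    by rewrite yj -uz -[X in u X]uj !perm_porbit // -yj.
  by move/fintype.subset_trans; apply; exact: finset.subD1set.
apply/eqP; rewrite finset.eqEsubset; case: ifPn => jO; apply/andP; split.
- apply: porbit_sub => [y|]; last by rewrite !inE porbit_id orbT.
  have [->|yz] := eqVneq y z; first by rewrite uz !inE perm_porbit ?orbT.
  have [->|yj] := eqVneq y j; first by rewrite uj !inE eqxx.
  by rewrite !inE uE // (negbTE yz) /= => yO; rewrite perm_porbit ?orbT.
- rewrite finset.subUset sub andbT finset.sub1set -uj perm_porbit //.
  exact: (fintype.subsetP sub).
- apply: porbit_sub => [y yO|]; last exact: porbit_id.
  rewrite uE ?perm_porbit //.
  + by apply: contraNneq zO => <-.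
  + by apply: contraNneq jO => <-.
- exact: sub.
Qed.

Lemma porbitsE_fixed s z : s z = z ->
  (porbits s :\ [set z])%SET = (porbit s @: [set~ z])%SET.
Proof.
move=> sz; apply/setP => c; rewrite !inE; apply/andP/imsetP.
  case=> cz /imsetP[x _ cE]; exists x => //; rewrite !inE.
  by apply: contra_neq cz => xz; rewrite cE xz porbit_fixed.
case=> x; rewrite !inE => xz ->; split; last exact: imset_f.
apply: contra_neq xz => /setP/(_ x).
by rewrite porbit_id finset.in_set1 => /esym/eqP.
Qed.

(** The insertion destroys the cycle {z} and enlarges the cycle through j, whose weight is assumed
    not to change; all other supports stay the same. *)
Lemma porbits_tpermM (R : comPzRingType) (g : {set T} -> R) s z j :
    s z = z -> j != z ->
    (forall x, j \in porbit s x -> g (z |: porbit s x)%SET = g (porbit s x)) ->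
  \prod_(c in porbits s) g c =
  g [set z]%SET * \prod_(c in porbits (tperm z j * s)%g) g c.
Proof.
move=> sz jz gj; set u := (tperm z j * s)%g.
have zs : [set z]%SET \in porbits s by rewrite -(porbit_fixed sz) imset_f.
rewrite (big_setD1 _ zs) /=; congr (_ * _).
pose h (c : {set T}) := if j \in c then (z |: c)%SET else c.
have zN c : c \in (porbits s :\ [set z])%SET -> z \notin c.
  rewrite porbitsE_fixed // => /imsetP[x xz ->].
  rewrite porbit_sym porbit_fixed // finset.in_set1 eq_sym.
  by rewrite !inE in xz; rewrite eq_sym.
have -> : porbits u = (h @: (porbits s :\ [set z]))%SET.
  rewrite porbitsE_fixed // -imset_comp.
  transitivity (porbit u @: [set~ z])%SET; last first.
    by apply: eq_in_imset => x; rewrite !inE /= => xz; rewrite porbit_tpermM.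
  apply/setP => c; apply/imsetP/imsetP => [[x _ ->]|[x _ ->]]; last by exists x.
  have [->|xz] := eqVneq x z; last by exists x; rewrite ?inE.
  exists j; first by rewrite !inE.
  apply/eqP; rewrite eq_porbit_mem; have <- : u j = z by rewrite permM tpermR.
  by rewrite perm_porbit // porbit_id.
rewrite big_imset /=; last first.
  move=> c d cP dP hcd.
  have hK (e : {set T}) : z \notin e -> (h e :\ z)%SET = e.
    move=> ze; rewrite /h; case: ifP => _; first by rewrite setU1K.
    by apply/finset.setDidPl; rewrite disjoint_sym disjoints1.
  by rewrite -(hK c) ?zN // hcd hK // zN.
apply: eq_bigr => c; rewrite porbitsE_fixed // => /imsetP[x _ ->].
by rewrite /h; case: ifPn => // /gj.
Qed.

End Porbit.

Definition rfact (R : pzSemiRingType) (a : R) (k : nat) : R :=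
  \prod_(j < k) (a + j%:R).

Lemma rfact0 (R : pzSemiRingType) (a : R) : rfact a 0 = 1.
Proof. by rewrite /rfact big_ord0. Qed.

Lemma rfactS (R : pzSemiRingType) (a : R) k :
  rfact a k.+1 = rfact a k * (a + k%:R).
Proof. by rewrite /rfact big_ord_recr. Qed.

Section InvariantPerm.
Variables (F : fieldType) (T C : finType) (al : C -> F) (f : T -> C).
Variable g : {set T} -> F.
Hypothesis al_neq0 : forall i, al i != 0.
(** Colour-preserving permutations have monochromatic cycles only, so their weights are determined
    by the colours. *)
Hypothesis gE : forall (c : {set T}) x,
  x \in c -> (forall y, y \in c -> f y = f x) -> g c = al (f x).

Let inv (s : {perm T}) := [forall x, f (s x) == f x].

Let class (A : {set T}) i := [set x in A | f x == i]%SET.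

Lemma inv_porbit (s : {perm T}) x y : inv s -> y \in porbit s x -> f y = f x.
Proof.
move=> /forallP fs /porbitP[k ->]; elim: k => [|k IHk]; first by rewrite perm1.
by rewrite expgSr permM (eqP (fs _)).
Qed.

Lemma perm_on_tpermM (A : {set T}) z j (s : {perm T}) : z \in A -> j \in A ->
  [&& perm_on A (tperm z j * s)%g, inv (tperm z j * s)%g & s z == z] =
  [&& perm_on (A :\ z)%SET s, inv s & f j == f z].
Proof.
move=> zA jA; set u := (tperm z j * s)%g.
have tA : perm_on A (tperm z j).
  apply/fintype.subsetP => x; rewrite inE.
  by case: tpermP => [->|->|]; rewrite ?eqxx.
have fu (P : f j = f z) x : f (tperm z j x) = f x by case: tpermP => [->|->|].
apply/and3P/and3P => [[uA iu /eqP sz]|[sA /forallP is_ /eqP fj]].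
  have fj : f j = f z.
    by rewrite -(eqP (forallP iu j)) permM tpermR sz.
  have sE x : s x = u (tperm z j x) by rewrite permM tpermK.
  split; last exact/eqP.
  - apply/fintype.subsetP => x; rewrite !inE => sx.
    rewrite (contraNneq _ sx) /=; last by move=> ->; rewrite sz.
    apply/negPn/negP => xA; move/negP: sx; apply; rewrite sE.
    by rewrite (out_perm tA xA) (out_perm uA xA).
  - by apply/forallP => x; rewrite sE (eqP (forallP iu _)) fu.
have sz : s z = z by apply: (out_perm sA); rewrite !inE eqxx.
split; last exact/eqP.
- apply: perm_onM => //; apply/fintype.subsetP => x /(fintype.subsetP sA).
  by rewrite !inE => /andP[].
- by apply/forallP => x; rewrite permM (eqP (is_ _)) fu.
Qed.

(* For z in A, write s = tperm z j * s' with s' fixing z: either j = z and z is a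
   new cycle, or z is inserted before j, in the cycle of j, whose colour it must
   then have. This gives the factor al (f z) + #|class (A :\ z) (f z)|. *)
Lemma sum_invariant_perm (A : {set T}) :
  \sum_(s : {perm T} | perm_on A s && inv s) \prod_(c in porbits s) g c =
  \prod_(x in ~: A) al (f x) * \prod_i rfact (al i) #|class A i|.
Proof.
elim: {A}#|A| {-2}A (erefl #|A|) => [|m IHm] A cardA.
  move/eqP: cardA; rewrite cards_eq0 => /eqP ->.
  rewrite [X in _ = _ * X]big1 ?mulr1; last first.
    move=> i _; rewrite (_ : class _ _ = finset.set0) ?cards0 ?rfact0 //.
    by apply/setP => x; rewrite !inE.
  rewrite (big_pred1 1%g) => [|s]; last first.
    apply/andP/eqP => [[s0 _]|->]; first by apply: (perm_on_id s0); rewrite cards0.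
    split; first exact: perm_on1.
    by apply/forallP => x; rewrite perm1.
  have p1 x : porbit 1%g x = [set x]%SET :> {set T}.
    by rewrite porbit_fixed ?perm1.
  rewrite /porbits big_imset /=; last first.
    by move=> x y _ _; rewrite !p1 => /finset.set1_inj.
  apply: eq_big => [x|x _]; first by rewrite !inE.
  by rewrite p1 (@gE _ x) ?inE // => y /finset.set1P ->.
have /card_gt0P[z zA] : (0 < #|A|)%N by rewrite cardA.
pose A' := (A :\ z)%SET.
have cardA' : #|A'| = m by move: cardA; rewrite (cardsD1 z) zA => -[].
rewrite (partition_big (fun s : {perm T} => s^-1%g z) (fun j => j \in A)); last first.
  by move=> s /andP[sA _]; rewrite (perm_closed _ (perm_onV sA)).
pose W := \sum_(s : {perm T} | perm_on A' s && inv s) \prod_(c in porbits s) g c.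
have inner j : j \in A ->
  \sum_(s : {perm T} | (perm_on A s && inv s) && (s^-1%g z == j))
    \prod_(c in porbits s) g c =
  if f j == f z then (if j == z then W else W / al (f z)) else 0.
  move=> jA; rewrite (reindex_inj (mulgI (tperm z j))) /=.
  have cond s : (perm_on A (tperm z j * s)%g && inv (tperm z j * s)%g)
      && ((tperm z j * s)^-1%g z == j) = [&& perm_on A' s, inv s & f j == f z].
    rewrite -perm_on_tpermM // -andbA; do 2!congr (_ && _).
    rewrite (can2_eq (permKV _) (permK _)) permM tpermR eq_sym.
    by [].
  rewrite (eq_bigl _ _ cond).
  have [fj|fj] := ifPn; last by rewrite big1 // => s; rewrite !andbF.
  have [->|jz] := eqVneq j z.
    by apply: eq_big => [s|s _]; rewrite ?andbT // tperm1 mul1g.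
  (* Here s fixes z, so [W] includes the weight [al (f z)] of the cycle {z}; the insertion before j
     removes exactly this factor. *)
  rewrite /W big_distrl /=; apply: eq_big => [s|s]; first by rewrite andbT.
  move=> /and3P[sA is_ _].
  have sz : s z = z by apply: (out_perm sA); rewrite !inE eqxx.
  rewrite [in RHS](porbits_tpermM sz jz).
    rewrite (@gE _ z) ?inE //; last by move=> y /finset.set1P ->.
    by rewrite mulrAC divff // mul1r.
  move=> x jx.
  have fO y : y \in porbit s x -> f y = f x by exact: inv_porbit.
  rewrite (@gE _ x) ?(@gE (porbit s x) x) ?porbit_id //.
    by rewrite !inE porbit_id orbT.
  move=> y; rewrite !inE => /orP[/eqP ->|/fO //].
  by rewrite -(eqP fj) fO.
rewrite (eq_bigr _ inner) -big_mkcondr /= (bigD1 z) ?zA ?eqxx //=.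
rewrite (eq_bigr (fun=> W / al (f z))); last first.
  by move=> j /andP[_ /negbTE ->].
rewrite sumr_const.
have -> : #|[pred j | (j \in A) && (f j == f z) & j != z]| = #|class A' (f z)|.
  by apply: eq_card => j; rewrite !inE andbC andbA.
have {}IHm := IHm _ cardA'.
rewrite -/W in IHm.
have Cz : (~: A' = z |: ~: A)%SET.
  by apply/setP => x; rewrite !inE negb_and negbK.
move: IHm; rewrite Cz big_setU1 /=; last by rewrite inE zA.
rewrite [X in _ * X](bigD1 (f z)) //= => WE.
rewrite [X in _ = _ * X](bigD1 (f z)) //=.
have -> : class A (f z) = (z |: class A' (f z))%SET.
  apply/setP => x; rewrite !inE; have [->|] := eqVneq x z; last by [].
  by rewrite zA eqxx.
rewrite cardsU1 !inE eqxx /= add1n rfactS.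
rewrite (eq_bigr (fun i => rfact (al i) #|class A' i|)); last first.
  move=> i ifz; congr (rfact _ #|pred_of_set _|).
  apply/setP => x; rewrite !inE; have [->|] := eqVneq x z; last by [].
  by rewrite zA /= eq_sym (negbTE ifz).
(* If m points of A other than z have the colour of z, the total is W + m W / al = (W / al) (al +
   m): the division takes z out of the complement, and al + m is the new factor of the rising
   factorial. *)
rewrite WE -[(_ / _) *+ _]mulr_natr.
set P1 := \prod_(i in _) _; set P2 := \prod_(i | _) _.
by field; rewrite al_neq0.
Qed.

End InvariantPerm.

(** * The joint law of two random divisors *)

Section DivisorSum.
Variable T : finType.
Implicit Types (s : {perm T}) (S : {set T}).

(** A divisor of s is encoded by the union of its cycles, an s-invariant set. Its size becomes a
    cardinal, and the sums over sets no longer depend on s, so they can be exchanged with the sum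
    over permutations. *)
Definition invset s S := [forall x, (s x \in S) == (x \in S)].

Definition orbits_in s S := [set c in porbits s | c \subset S]%SET.

Lemma invset_porbit s S x : invset s S -> (porbit s x \subset S) = (x \in S).
Proof.
move=> /forallP iS; apply/idP/idP => [/fintype.subsetP|xS].
  by apply; exact: porbit_id.
by apply: porbit_sub => // y; rewrite (eqP (iS y)).
Qed.

Lemma mem_cover_orbits_in s S x :
  (x \in finset.cover (orbits_in s S)) = (porbit s x \subset S).
Proof.
apply/finset.bigcupP/idP => [[c]|xS]; last first.
  by exists (porbit s x); rewrite ?porbit_id // inE xS imset_f.
rewrite inE => /andP[/imsetP[y _ ->] yS].
by rewrite -eq_porbit_mem => /eqP ->.
Qed.

Lemma trivIset_porbits s : finset.trivIset (porbits s).
Proof.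
apply/finset.trivIsetP => c d /imsetP[x _ ->] /imsetP[y _ ->] xy.
rewrite -finset.setI_eq0; apply/eqP/setP => z; rewrite !inE.
apply: contra_neqF xy => /andP[].
by rewrite -!eq_porbit_mem => /eqP <- /eqP <-.
Qed.

Lemma card_orbits_in s S : invset s S ->
  (\sum_(c in orbits_in s S) #|c|)%N = #|S|.
Proof.
move=> iS; have : finset.trivIset (orbits_in s S).
  apply: (finset.trivIsetS _ (trivIset_porbits s)).
  by apply/fintype.subsetP => c; rewrite inE => /andP[].
rewrite /finset.trivIset => /eqP ->; apply: eq_card => x.
by rewrite mem_cover_orbits_in invset_porbit.
Qed.

Lemma sum_divisors (V : nmodType) s (G : {set {set T}} -> V) :
  \sum_(d : {set {set T}} | d \subset porbits s) G d =
  \sum_(S : {set T} | invset s S) G (orbits_in s S).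
Proof.
rewrite (reindex_onto (orbits_in s) (@finset.cover T)) /=; last first.
  move=> d /fintype.subsetP dP; apply/setP => c; rewrite inE.
  apply/andP/idP => [[/imsetP[x _ ->] xd]|cd]; last first.
    by split; [exact: dP|apply: finset.bigcup_sup].
  have /finset.bigcupP[c' c'd] : x \in finset.cover d.
    by apply: (fintype.subsetP xd); exact: porbit_id.
  have /imsetP[y _ c'E] := dP _ c'd.
  by rewrite c'E -eq_porbit_mem => /eqP ->; rewrite -c'E.
apply: eq_bigl => S; apply/andP/idP => [[_ /eqP SE]|iS].
  apply/forallP => x; rewrite -SE !mem_cover_orbits_in.
  by rewrite -(porbit_perm s 1 x) expg1 eqxx.
split; first by apply/fintype.subsetP => c; rewrite inE => /andP[].
by apply/eqP/setP => x; rewrite mem_cover_orbits_in invset_porbit.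
Qed.

Lemma sum_subsets (V : nmodType) (A : {set T}) (F : nat -> V) :
  \sum_(B : {set T} | B \subset A) F #|B| =
  \sum_(j < #|A|.+1) F j *+ 'C(#|A|, j).
Proof.
rewrite (partition_big (fun B : {set T} => inord #|B| : 'I_#|A|.+1) xpredT) //=.
apply: eq_bigr => j _; rewrite -cards_draws -sumr_const.
apply: eq_big => [B|B /andP[BA /eqP <-]].
  rewrite inE; apply: andb_id2l => BA.
  by rewrite -val_eqE /= inordK // ltnS subset_leq_card.
by rewrite inordK // ltnS subset_leq_card.
Qed.

Lemma sum_split_set (V : nmodType) S (F : nat -> nat -> V) :
  \sum_(S' : {set T}) F #|(S' :&: S)%SET| #|(S' :\: S)%SET| =
  \sum_(i < #|S|.+1) \sum_(j < #|(~: S)%SET|.+1)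
    F i j *+ 'C(#|(~: S)%SET|, j) *+ 'C(#|S|, i).
Proof.
transitivity (\sum_(P : {set T} | P \subset S)
    \sum_(Q : {set T} | Q \subset (~: S)%SET) F #|P| #|Q|); last first.
  rewrite (sum_subsets S (fun i =>
    \sum_(Q : {set T} | Q \subset (~: S)%SET) F i #|Q|)).
  by apply: eq_bigr => i _; rewrite sum_subsets sumrMnl.
rewrite pair_big /=.
rewrite [RHS](reindex_onto (fun S' => (S' :&: S, S' :\: S)%SET)
  (fun p => p.1 :|: p.2)%SET) /=.
  apply: eq_bigl => S'; rewrite finset.subsetIr /=.
  rewrite finset.setDE finset.subsetIr /= -finset.setIUr finset.setUCr.
  by rewrite finset.setIT eqxx.
move=> [P Q] /= /andP[/fintype.subsetP PS /fintype.subsetP QS].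
congr pair; apply/setP => x; rewrite !inE.
  have [/PS ->|xP] //= := boolP (x \in P).
  by apply/negP => /andP[/QS]; rewrite inE => /negbTE ->.
have [/PS xS|xP] /= := boolP (x \in P).
  by rewrite xS; apply/esym/negP => /QS; rewrite inE xS.
by apply: andb_idl => /QS; rewrite inE.
Qed.

End DivisorSum.

Section PairMass.
Variables (R : numFieldType) (b : R).

Definition side (c : bool) : R := if c then b else 1 - b.

(** The coefficient of x^k in (1 - x)^(-a). *)
Definition cf (a : R) (k : nat) : R := rfact a k / k`!%:R.

(* The joint law of the unions of the cycles of two independent divisors of a
   uniform random permutation of [T], each cycle being kept with probability [b]. *)
Definition pair_mass (T : finType) (S1 S2 : {set T}) : R :=
  (\prod_(i : bool * bool)
     rfact (side i.1 * side i.2) #|[set x | (x \in S1, x \in S2) == i]%SET|)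
  / (#|T|)`!%:R.

(** The indices k, i, l are the cardinals of S1, of its intersection with S2, and of S2 minus S1.
    The three binomials counting such pairs turn 1 / n! into the four factorials hidden in [cf]. *)
Lemma sum_pair_mass (T : finType) (Phi : nat -> nat -> R) :
  \sum_(S1 : {set T}) \sum_(S2 : {set T})
     Phi #|S1| #|S2| * pair_mass S1 S2 =
  \sum_(k < #|T|.+1) \sum_(i < k.+1) \sum_(l < (#|T| - k).+1)
     Phi k (i + l)%N * (cf (b * b) i * cf (b * (1 - b)) (k - i) *
       (cf ((1 - b) * b) l * cf ((1 - b) * (1 - b)) (#|T| - k - l))).
Proof.
set n := #|T|.
pose W k i l := Phi k (i + l)%N *
  (rfact (b * b) i * rfact (b * (1 - b)) (k - i) *
   (rfact ((1 - b) * b) l * rfact ((1 - b) * (1 - b)) (n - k - l)) / n`!%:R).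
have E1 (S1 : {set T}) :
    \sum_(S2 : {set T}) Phi #|S1| #|S2| * pair_mass S1 S2 =
    \sum_(i < #|S1|.+1) \sum_(l < (n - #|S1|).+1)
       W #|S1| i l *+ 'C(n - #|S1|, l) *+ 'C(#|S1|, i).
  have <- : #|(~: S1)%SET| = (n - #|S1|)%N by rewrite cardsCs finset.setCK.
  rewrite -sum_split_set; apply: eq_bigr => S2 _; rewrite /W.
  rewrite -(cardsID S1 S2); congr (_ * _).
  rewrite /pair_mass; congr (_ / _).
  rewrite -(pair_bigA _ (fun c d =>
    rfact (side c * side d) #|[set x | (x \in S1, x \in S2) == (c, d)]%SET|)) /=.
  rewrite !big_bool /= /side.
  congr (rfact _ _ * rfact _ _ * (rfact _ _ * rfact _ _)).
  - by apply: eq_card => x; rewrite !inE xpair_eqE !eqb_id andbC.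
  - rewrite -[in RHS](cardsID S2 S1) finset.setIC addKn.
    by apply: eq_card => x; rewrite !inE xpair_eqE eqb_id eqbF_neg andbC.
  - by apply: eq_card => x; rewrite !inE xpair_eqE eqb_id eqbF_neg.
  - have -> : (n - #|S1|)%N = #|(~: S1)%SET| by rewrite [RHS]cardsCs finset.setCK.
    rewrite -[in RHS](cardsID S2 (~: S1)%SET) [(_ :&: S2)%SET]finset.setIC.
    rewrite -finset.setDE addKn.
    by apply: eq_card => x; rewrite !inE xpair_eqE !eqbF_neg andbC.
rewrite (eq_bigr _ (fun S1 _ => E1 S1)).
pose G k := \sum_(i < k.+1)
  \sum_(l < (n - k).+1) W k i l *+ 'C(n - k, l) *+ 'C(k, i).
transitivity (\sum_(B : {set T} | B \subset finset.setT) G #|B|).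
  by apply: eq_bigl => B; rewrite finset.subsetT.
rewrite sum_subsets cardsT -/n.
apply: eq_bigr => k _; rewrite /G -sumrMnl; apply: eq_bigr => i _.
rewrite -sumrMnl; apply: eq_bigr => l _; rewrite /W.
have kn : (k <= n)%N by rewrite -ltnS.
have ik : (i <= k)%N by rewrite -ltnS.
have ln : (l <= n - k)%N by rewrite -ltnS.
have f0 m : m`!%:R != 0 :> R by rewrite pnatr_eq0 -lt0n fact_gt0.
have e1 : n`!%:R = 'C(n, k)%:R * (k`!%:R * (n - k)`!%:R) :> R.
  by rewrite -!natrM bin_fact.
have e2 : k`!%:R = 'C(k, i)%:R * (i`!%:R * (k - i)`!%:R) :> R.
  by rewrite -!natrM bin_fact.
have e3 : (n - k)`!%:R = 'C(n - k, l)%:R * (l`!%:R * (n - k - l)`!%:R) :> R.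
  by rewrite -!natrM bin_fact.
have c1 : 'C(n, k)%:R != 0 :> R by rewrite pnatr_eq0 -lt0n bin_gt0.
have c2 : 'C(k, i)%:R != 0 :> R by rewrite pnatr_eq0 -lt0n bin_gt0.
have c3 : 'C(n - k, l)%:R != 0 :> R by rewrite pnatr_eq0 -lt0n bin_gt0.
rewrite -!mulrnA -[_ *+ _]mulr_natr !natrM e1 e2 e3 /cf.
by field; rewrite c1 c2 c3 !f0.
Qed.

Lemma side_neq0 (b_gt0 : 0 < b) (b_lt1 : b < 1) c : side c != 0.
Proof.
by rewrite /side; case: c; rewrite gt_eqF // subr_gt0.
Qed.

(** The colour of a point is its pair of memberships in S1 and S2: both sets are invariant exactly
    when s preserves colours. *)
Lemma pair_massE (b_gt0 : 0 < b) (b_lt1 : b < 1) (T : finType)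
    (S1 S2 : {set T}) :
  (\sum_(s : {perm T} | invset s S1 && invset s S2)
     \prod_(c in porbits s) (side (c \subset S1) * side (c \subset S2)))
  / (#|T|)`!%:R = pair_mass S1 S2.
Proof.
rewrite /pair_mass; congr (_ / _).
pose f (x : T) := (x \in S1, x \in S2).
pose al (i : bool * bool) := side i.1 * side i.2.
have := @sum_invariant_perm R T (bool * bool)%type al f
  (fun c => side (c \subset S1) * side (c \subset S2)) _ _ finset.setT.
rewrite finset.setCT big_set0 mul1r => main.
rewrite (eq_bigl (fun s : {perm T} => perm_on finset.setT s &&
    [forall x, f (s x) == f x])) ?main => [|i|c x xc cx|s].
- apply: eq_bigr => i _; congr (rfact _ #|pred_of_set _|).
  by apply/setP => x; rewrite !inE.
- by rewrite mulf_neq0 // side_neq0.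
- have mem (S : {set T}) : (forall y, y \in c -> (y \in S) = (x \in S)) ->
      (c \subset S) = (x \in S).
    move=> cS; apply/idP/idP => [/fintype.subsetP -> //|xS].
    by apply/fintype.subsetP => y /cS ->.
  by rewrite /al /= !mem // => y /cx [].
- have -> : perm_on finset.setT s by apply/fintype.subsetP => x; rewrite inE.
  apply/andP/forallP => [[/forallP i1 /forallP i2] x|ss].
    by rewrite xpair_eqE i1 i2.
  by split; apply/forallP => x; have /eqP[e1 e2] := ss x; rewrite ?e1 ?e2.
Qed.

Lemma pair_massC (T : finType) (S1 S2 : {set T}) :
  pair_mass S1 S2 = pair_mass S2 S1.
Proof.
rewrite /pair_mass; congr (_ / _).
rewrite (reindex_inj (h := fun i : bool * bool => (i.2, i.1))) /=; last first.
  by move=> [? ?] [? ?] [-> ->].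
apply: eq_bigr => -[c d] _ /=; rewrite mulrC; congr (rfact _ #|pred_of_set _|).
by apply/setP => x; rewrite !inE !xpair_eqE andbC.
Qed.

End PairMass.

Lemma pair_mass_setC (R : numFieldType) (b : R) (T : finType)
    (S1 S2 : {set T}) :
  pair_mass b (~: S1)%SET (~: S2)%SET = pair_mass (1 - b) S1 S2.
Proof.
rewrite /pair_mass; congr (_ / _).
rewrite (reindex_inj (h := fun i : bool * bool => (~~ i.1, ~~ i.2))) /=; last first.
  by move=> [? ?] [? ?] [/negb_inj -> /negb_inj ->].
apply: eq_bigr => -[c d] _ /=; congr (rfact _ _).
  by rewrite /side; case: c; case: d; rewrite /= ?subKr.
by apply: eq_card => x; rewrite !inE !xpair_eqE !(inj_eq negb_inj).
Qed.

(** The sum of all divisor weights is (1 + vtheta)^(number of cycles). Distributing this denominator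
    over the cycles gives theta for a kept cycle and 1 - theta for an omitted one. *)
Lemma divisor_processE (R : realType) (vtheta : R) n (s : 'S_n) (t : R) :
  0 < vtheta ->
  divisor_process vtheta s t =
  \sum_(S : {set 'I_n} | invset s S && (#|S|%:R <= t * n%:R))
    \prod_(c in porbits s) side (vtheta / (1 + vtheta)) (c \subset S).
Proof.
move=> v0; have v1 : 1 + vtheta != 0 by rewrite gt_eqF // addr_gt0.
rewrite /divisor_process.
have -> : weight_sum vtheta s = (1 + vtheta) ^+ #|porbits s|.
  rewrite /weight_sum /divisor_weight /ncycles /divisor.
  by rewrite (sum_subsets (porbits s) (fun k => vtheta ^+ k)) exprDn;
     apply: eq_bigr => i _; rewrite expr1n mul1r.
rewrite big_mkcondr /= /divisor.
rewrite (sum_divisors s (fun d =>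
  if (divisor_size d)%:R <= t * n%:R then divisor_weight vtheta d else 0)).
rewrite mulr_sumr [RHS]big_mkcondr /=; apply: eq_bigr => S iS.
rewrite /divisor_size card_orbits_in //; case: ifP => _; last by rewrite mulr0.
rewrite /divisor_weight /ncycles -!prodr_const.
have -> : \prod_(c in orbits_in s S) vtheta =
    \prod_(c in porbits s) (if c \subset S then vtheta else 1).
  by rewrite -big_mkcondr; apply: eq_bigl => c; rewrite inE.
rewrite -prodfV -big_split /=; apply: eq_bigr => c _.
by rewrite /side; case: ifP => _; field.
Qed.

(** With a strict bound, K is the number of admissible sizes, and n + 1 - K that of the remaining
    ones. *)
Definition pair_cdf (R : numFieldType) (b : R) (n K : nat) : R :=
  \sum_(S1 : {set 'I_n} | (#|S1| < K)%N) \sum_(S2 : {set 'I_n} | (#|S2| < K)%N)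
    pair_mass b S1 S2.

Lemma perm_expectation_sqr (R : realType) (vtheta : R) n (t : R) (K : nat) :
  0 < vtheta -> (forall k, (k < K)%N = (k%:R <= t * n%:R)) ->
  perm_expectation (fun s : 'S_n => divisor_process vtheta s t ^+ 2) =
  pair_cdf (vtheta / (1 + vtheta)) n K.
Proof.
move=> v0 KE; set b := vtheta / (1 + vtheta).
have v1 : 0 < 1 + vtheta by rewrite addr_gt0.
have b0 : 0 < b by rewrite divr_gt0.
have b1 : b < 1 by rewrite ltr_pdivrMr // mul1r ltrDr.
rewrite /perm_expectation card_Sn.
transitivity (\sum_(s : 'S_n) (\sum_(S1 : {set 'I_n} | (#|S1| < K)%N)
   \sum_(S2 : {set 'I_n} | (#|S2| < K)%N)
   (if invset s S1 && invset s S2 then \prod_(c in porbits s)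
      (side b (c \subset S1) * side b (c \subset S2)) else 0)) / n`!%:R).
  rewrite mulr_suml; apply: eq_bigr => s _; congr (_ / _).
  rewrite divisor_processE // expr2 big_distrl /=.
  rewrite (eq_bigl (fun S : {set _} => (#|S| < K)%N && invset s S)); last first.
    by move=> S; rewrite KE andbC.
  rewrite big_mkcondr /=; apply: eq_bigr => S1 _; case: ifP => iS1; last first.
    by rewrite big1.
  rewrite big_distrr /=.
  rewrite (eq_bigl (fun S : {set _} => (#|S| < K)%N && invset s S)); last first.
    by move=> S; rewrite KE andbC.
  rewrite big_mkcondr /=; apply: eq_bigr => S2 _; case: ifP => iS2 //.
  by rewrite big_split.
rewrite -mulr_suml exchange_big /= mulr_suml; apply: eq_bigr => S1 _.
rewrite exchange_big /= mulr_suml; apply: eq_bigr => S2 _.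
by rewrite -big_mkcond -pair_massE // card_ord.
Qed.

(** * Rearrangement of triangular sums *)

Section TriangularSums.
Variable V : nmodType.

Lemma sum_triangle (F : nat -> nat -> V) K :
  \sum_(k < K) \sum_(i < k.+1) F k i =
  \sum_(i < K) \sum_(w < K - i) F (w + i)%N i.
Proof.
elim: K => [|K IHK]; first by rewrite !big_ord0.
rewrite big_ord_recr /= IHK.
have -> : \sum_(i < K) \sum_(w < K - i) F (w + i)%N i =
          \sum_(i < K.+1) \sum_(w < K - i) F (w + i)%N i.
  by rewrite big_ord_recr /= subnn big_ord0 addr0.
rewrite -big_split /=; apply: eq_bigr => i _.
have iK : (i <= K)%N by rewrite -ltnS.
by rewrite subSn // big_ord_recr /= subnK.
Qed.

Lemma sum_triangleC (F : nat -> nat -> V) K :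
  \sum_(i < K) \sum_(w < K - i) F i w = \sum_(w < K) \sum_(i < K - w) F i w.
Proof.
transitivity (\sum_(i < K) \sum_(w < K | (i + w < K)%N) F i w).
  apply: eq_bigr => i _; rewrite (big_ord_widen K) ?leq_subr //.
  by apply: eq_bigl => w; rewrite ltn_subRL.
rewrite (exchange_big_dep xpredT) //=; apply: eq_bigr => w _.
rewrite [RHS](big_ord_widen K (fun i => F i w)) ?leq_subr //.
by apply: eq_bigl => i; rewrite ltn_subRL addnC.
Qed.

(** The pairs with l >= w are reflected to l <= w; the diagonal thus goes to the second sum. *)
Lemma sum_square_sym (F : nat -> nat -> V) m : (forall w l, F w l = F l w) ->
  \sum_(w < m) \sum_(l < m) F w l =
  \sum_(w < m) \sum_(l < w) F w l + \sum_(w < m) \sum_(l < w.+1) F w l.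
Proof.
move=> FC; elim: m => [|m IHm]; first by rewrite !big_ord0 addr0.
rewrite big_ord_recr /= (eq_bigr _ (fun i _ => big_ord_recr _ _)) /=.
rewrite big_split /= IHm (eq_bigr _ (fun (i : 'I_m) _ => FC i m)).
rewrite [X in _ = X + _]big_ord_recr [X in _ = _ + X]big_ord_recr /=.
by rewrite addrACA !addrA.
Qed.

End TriangularSums.

(** * Coefficients of (1 - x)^(-a) *)

Section RisingCoefficients.
Variable R : numFieldType.
Implicit Types a b : R.

Lemma cf0 a : cf a 0 = 1.
Proof. by rewrite /cf rfact0 divr1. Qed.

Lemma cfS a k : k.+1%:R * cf a k.+1 = (a + k%:R) * cf a k.
Proof.
rewrite /cf rfactS factS natrM.
have f0 : k`!%:R != 0 :> R by rewrite pnatr_eq0 -lt0n fact_gt0.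
have : k.+1%:R != 0 :> R by rewrite pnatr_eq0.
by move: k.+1%:R => m m0; field; rewrite f0.
Qed.

Lemma cf_ge0 a k : 0 <= a -> 0 <= cf a k.
Proof.
by move=> a0; rewrite divr_ge0 ?ler0n // prodr_ge0 // => i _; rewrite addr_ge0.
Qed.

Lemma cf1 n : cf (1 : R) n = 1.
Proof.
elim: n => [|n IHn]; first exact: cf0.
apply: (@mulfI _ n.+1%:R); first by rewrite pnatr_eq0.
by rewrite cfS IHn nat1r.
Qed.

(** Compares coefficients in (1 - x)^(-a) (1 - x)^(-b). Splitting n + 1 = k + (n + 1 - k) and
    applying [cfS] to either factor is the product rule for the derivative. *)
Lemma cf_convolution a b n :
  \sum_(k < n.+1) cf a k * cf b (n - k) = cf (a + b) n.
Proof.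
elim: n => [|n IHn]; first by rewrite big_ord1 !cf0 mulr1.
apply: (@mulfI _ n.+1%:R); first by rewrite pnatr_eq0.
rewrite cfS -IHn !mulr_sumr.
rewrite (eq_bigr (fun k : 'I_n.+2 => (k%:R * cf a k) * cf b (n.+1 - k) +
   cf a k * ((n.+1 - k)%:R * cf b (n.+1 - k)))); last first.
  move=> k _; have kn : (k <= n.+1)%N by rewrite -ltnS.
  by rewrite -[X in X%:R * _](subnKC kn) natrD; ring.
rewrite big_split /= big_ord_recl /= !mul0r add0r.
rewrite [X in _ + X]big_ord_recr /= subnn mul0r mulr0 addr0 -big_split /=.
apply: eq_bigr => k _; have kn : (k <= n)%N by rewrite -ltnS.
rewrite /bump /= add1n subSS subSn // !cfS.
have -> : n%:R = k%:R + (n - k)%:R :> R by rewrite -natrD subnKC.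
by ring.
Qed.

Lemma cf_partial_sum a n : \sum_(k < n.+1) cf a k = cf (a + 1) n.
Proof. by rewrite -cf_convolution; apply: eq_bigr => k _; rewrite cf1 mulr1. Qed.

Lemma cf_shift a n : a * cf (a + 1) n = (a + n%:R) * cf a n.
Proof.
elim: n => [|n IHn]; first by rewrite !cf0 addr0.
apply: (@mulfI _ n.+1%:R); first by rewrite pnatr_eq0.
rewrite mulrCA cfS mulrCA IHn (mulrCA _ _ (cf a n.+1)) cfS.
by rewrite -natr1; ring.
Qed.

End RisingCoefficients.

(** * Distribution functions of one and of two divisor sizes *)

Section PairCdf.
Variable R : numFieldType.
Implicit Types b : R.

Definition size_cdf b n K : R := \sum_(k < K) cf b k * cf (1 - b) (n - k).

Lemma size_cdf_total b n : size_cdf b n n.+1 = 1.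
Proof. by rewrite /size_cdf cf_convolution subrKC cf1. Qed.

(** The two inner sums are convolutions with parameters adding up to b and to 1 - b, so they
    collapse to the marginal law of the first size. *)
Lemma sum_pair_mass_fst b n (A : pred nat) :
  \sum_(S1 : {set 'I_n}) \sum_(S2 : {set 'I_n}) (A #|S1|)%:R * pair_mass b S1 S2 =
  \sum_(k < n.+1) (A k)%:R * (cf b k * cf (1 - b) (n - k)).
Proof.
rewrite (sum_pair_mass b _ (fun k _ => (A k)%:R)) card_ord.
apply: eq_bigr => k _; have kn : (k <= n)%N by rewrite -ltnS.
transitivity ((A k)%:R * ((\sum_(i < k.+1) cf (b * b) i * cf (b * (1 - b)) (k - i)) *
  (\sum_(l < (n - k).+1) cf ((1 - b) * b) l * cf ((1 - b) * (1 - b)) (n - k - l)))).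
  rewrite big_distrl /= mulr_sumr; apply: eq_bigr => i _.
  by rewrite big_distrr /= mulr_sumr.
by rewrite !cf_convolution -!mulrDr subrKC !mulr1.
Qed.

(** For indicators, I1 I2 = I1 + I2 - 1 + (1 - I1)(1 - I2), and a set has at least K points exactly
    when its complement has fewer than n + 1 - K. *)
Lemma pair_cdf_compl b n K : (K <= n.+1)%N ->
  pair_cdf b n K = 2 * size_cdf b n K - 1 + pair_cdf (1 - b) n (n.+1 - K).
Proof.
move=> Kn; pose I (S : {set 'I_n}) : R := (#|S| < K)%N%:R.
have PE c L : pair_cdf c n L = \sum_(S1 : {set 'I_n}) \sum_(S2 : {set 'I_n})
    (#|S1| < L)%N%:R * (#|S2| < L)%N%:R * pair_mass c S1 S2.
  rewrite /pair_cdf big_mkcond; apply: eq_bigr => S1 _; case: ifP => _; last first.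
    by rewrite big1 // => S2 _; rewrite !mul0r.
  rewrite big_mkcond; apply: eq_bigr => S2 _; rewrite mul1r.
  by case: ifP => _; rewrite ?mul1r ?mul0r.
have margE : \sum_(S1 : {set 'I_n}) \sum_(S2 : {set 'I_n}) I S1 * pair_mass b S1 S2
    = size_cdf b n K.
  rewrite (sum_pair_mass_fst _ _ (fun k => (k < K)%N)) /size_cdf.
  rewrite (big_ord_widen n.+1 (fun k : nat => cf b k * cf (1 - b) (n - k))) //.
  rewrite [RHS]big_mkcond /=; apply: eq_bigr => k _.
  by case: ifP => _; rewrite ?mul1r ?mul0r.
have totE : \sum_(S1 : {set 'I_n}) \sum_(S2 : {set 'I_n}) pair_mass b S1 S2 = 1.
  transitivity (\sum_(S1 : {set 'I_n}) \sum_(S2 : {set 'I_n})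
      true%:R * pair_mass b S1 S2).
    by do 2!(apply: eq_bigr => ? _); rewrite mulr1n mul1r.
  rewrite (sum_pair_mass_fst b n (fun=> true)) -[RHS](size_cdf_total b n).
  by apply: eq_bigr => k _; rewrite mulr1n mul1r.
have complE : pair_cdf (1 - b) n (n.+1 - K) =
    \sum_(S1 : {set 'I_n}) \sum_(S2 : {set 'I_n})
    (1 - I S1) * (1 - I S2) * pair_mass b S1 S2.
  have sizeE (S : {set 'I_n}) : (#|(~: S)%SET| < n.+1 - K)%N%:R = 1 - I S.
    have Sn : (#|S| <= n)%N by rewrite -[X in (_ <= X)%N]card_ord max_card.
    have -> : #|(~: S)%SET| = (n - #|S|)%N.
      by rewrite [LHS]cardsCs finset.setCK card_ord.
    rewrite /I; have -> : (n - #|S| < n.+1 - K)%N = ~~ (#|S| < K)%N by lia.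
    by case: ltnP; rewrite ?subrr ?subr0.
  rewrite PE (reindex_inj (@finset.setC_inj _)); apply: eq_bigr => S1 _.
  rewrite (reindex_inj (@finset.setC_inj _)); apply: eq_bigr => S2 _.
  by rewrite !sizeE pair_mass_setC subKr.
have sumE : pair_cdf b n K = \sum_(S1 : {set 'I_n}) \sum_(S2 : {set 'I_n})
   (I S1 * pair_mass b S1 S2 + I S2 * pair_mass b S1 S2 - pair_mass b S1 S2 +
    (1 - I S1) * (1 - I S2) * pair_mass b S1 S2).
  rewrite PE; do 2!(apply: eq_bigr => ? _); rewrite -/(I _) -/(I _); ring.
rewrite sumE complE.
rewrite (eq_bigr _ (fun _ _ => big_split _ _ _ _ _)) big_split /=; congr (_ + _).
rewrite (eq_bigr _ (fun _ _ => big_split _ _ _ _ _)) big_split /=.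
rewrite (eq_bigr _ (fun _ _ => big_split _ _ _ _ _)) big_split /=.
rewrite margE.
have -> : \sum_(S1 : {set 'I_n}) \sum_(S2 : {set 'I_n}) I S2 * pair_mass b S1 S2
    = size_cdf b n K.
  rewrite exchange_big -margE; apply: eq_bigr => S1 _; apply: eq_bigr => S2 _.
  by rewrite pair_massC.
rewrite (eq_bigr _ (fun _ _ => sumrN _ _ _)) sumrN totE; ring.
Qed.

(** Here v counts the points in both sets and n - w - v - u those in neither. *)
Definition half_sum b n K e : R :=
  \sum_(w < K) cf (b * (1 - b)) w * \sum_(v < K - w) cf (b * b) v *
    \sum_(u < w + e) cf (b * (1 - b)) u * cf ((1 - b) * (1 - b)) (n - w - v - u).

(* w, u are the numbers of points in exactly one of the two sets; e = 0 and e = 1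
   account for u < w and, after exchanging u and w, for u >= w. *)
Lemma pair_cdf_half_sum b n K : (2 * K <= n + 2)%N ->
  pair_cdf b n K = half_sum b n K 0 + half_sum b n K 1.
Proof.
move=> Kn; set c := b * (1 - b); set D := (1 - b) * (1 - b).
pose G i w l := cf (b * b) i * (cf c w * (cf c l * cf D (n - (w + i) - l))).
transitivity (\sum_(i < K) \sum_(w < K - i) \sum_(l < K - i) G i w l).
  transitivity (\sum_(k < K) \sum_(i < k.+1) \sum_(l < K - i) G i (k - i)%N l);
    last first.
    rewrite (sum_triangle (fun k i => \sum_(l < K - i) G i (k - i)%N l)).
    apply: eq_bigr => i _; apply: eq_bigr => w _; apply: eq_bigr => l _.
    by rewrite addnK.
  pose Phi k m : R := (k < K)%N%:R * (m < K)%N%:R.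
  transitivity (\sum_(S1 : {set 'I_n}) \sum_(S2 : {set 'I_n})
     Phi #|S1| #|S2| * pair_mass b S1 S2).
    rewrite /pair_cdf big_mkcond; apply: eq_bigr => S1 _; rewrite /Phi.
    case: ifP => _; last by rewrite big1 // => S2 _; rewrite !mul0r.
    rewrite big_mkcond; apply: eq_bigr => S2 _; rewrite mul1r.
    by case: ifP => _; rewrite ?mul1r ?mul0r.
  rewrite sum_pair_mass card_ord.
  have Kn1 : (K <= n.+1)%N by lia.
  rewrite [RHS](big_ord_widen n.+1 (fun k => \sum_(i < k.+1)
    \sum_(l < K - i) G i (k - i)%N l)) // [RHS]big_mkcond /=.
  apply: eq_bigr => k _; rewrite /Phi; case: ifP => kK; last first.
    by rewrite big1 // => i _; rewrite big1 // => l _; rewrite !mul0r.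
  apply: eq_bigr => i _; have ik : (i <= k)%N by rewrite -ltnS.
  (* The inequality K - i <= n - k + 1 is tightest at i = 0, k = K - 1, where it reads 2 K <= n +
     2. *)
  rewrite [RHS](big_ord_widen (n - k).+1 (fun l => G i (k - i)%N l)); last by lia.
  rewrite [RHS]big_mkcond /=; apply: eq_bigr => l _.
  rewrite mul1r ltn_subRL; case: ifP => _; last by rewrite mul0r.
  by rewrite mul1r /G subnK // [(1 - b) * b]mulrC -/c -/D; ring.
have symG i w l : G i w l = G i l w.
  rewrite /G; have -> : (n - (w + i) - l = n - (l + i) - w)%N by lia.
  ring.
rewrite (eq_bigr _ (fun (i : 'I_K) _ => sum_square_sym (K - i) (symG i))) big_split /=.
congr (_ + _).
  rewrite (sum_triangleC (fun i w => \sum_(l < w) G i w l)).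
  apply: eq_bigr => w _; rewrite mulr_sumr; apply: eq_bigr => v _.
  rewrite addn0 !mulr_sumr; apply: eq_bigr => u _.
  by rewrite /G subnDA; ring.
rewrite (sum_triangleC (fun i w => \sum_(l < w.+1) G i w l)).
apply: eq_bigr => w _; rewrite mulr_sumr; apply: eq_bigr => v _.
rewrite addn1 !mulr_sumr; apply: eq_bigr => u _.
by rewrite /G subnDA; ring.
Qed.

End PairCdf.

Local Open Scope classical_set_scope.

(** * The Gamma function *)

Section GammaFunction.
Context {R : realType}.
Notation mu := (@lebesgue_measure R).
Implicit Types (x s p c : R).

Lemma is_derive_powR s x : 0 < x ->
  is_derive x 1 (fun y : R => y `^ s) (s * x `^ (s - 1)).
Proof.
move=> x0; have xI : x \in (`]0, +oo[)%R by rewrite in_itv/= x0.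
apply: DeriveDef; first exact: derivable_powR.
by rewrite -derive1E powR_derive1.
Qed.

Lemma continuous_powR s x : 0 < x -> {for x, continuous (fun y : R => y `^ s)}.
Proof.
move=> x0; apply: differentiable_continuous; apply/derivable1_diffP.
exact: (@ex_derive _ _ _ _ _ _ _ (is_derive_powR s x0)).
Qed.

Lemma is_derive_expRM c x :
  is_derive x 1 (fun y : R => expR (c * y)) (c * expR (c * x)).
Proof.
rewrite mulrC; apply: (@is_derive1_comp _ expR (fun y => c * y)).
have := @is_deriveM _ _ (cst c) id x 1 0 1 _ _.
by rewrite /= scaler0 addr0 /GRing.scale/= mulr1 => H; apply: H.
Qed.

(** Uses ln (1 + y) <= y at y = x / (2 s) - 1. The power is absorbed by half of the exponential
    decay, and the other half remains integrable. *)
Lemma powR_le_expR s x : 0 < s -> 0 < x ->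
  x `^ s <= (2 * s) `^ s * expR (x / 2).
Proof.
move=> s0 x0; have s2 : 0 < 2 * s by rewrite mulr_gt0.
rewrite /powR !gt_eqF // -expRD ler_expR.
have y0 : 0 < x / (2 * s) by rewrite divr_gt0.
have -> : x = (2 * s) * (1 + (x / (2 * s) - 1)).
  by field; rewrite gt_eqF.
rewrite lnM ?posrE //; last by rewrite subrKC.
rewrite mulrDr lerD2l.
have := @le_ln1Dx R (x / (2 * s) - 1).
rewrite ltrBrDl subrr y0 => /(_ isT) h.
apply: (le_trans (ler_wpM2l (ltW s0) h)).
rewrite (_ : _ / 2 = s * (x / (2 * s))); last by field; rewrite gt_eqF.
by rewrite ler_pM2l // lerBlDr lerDl.
Qed.

Lemma integral_expRN c : 0 < c ->
  (\int[mu]_(x in `]0%R, +oo[) (expR (- c * x))%:E = c^-1%:E)%E.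
Proof.
move=> c0; have d x := @is_derive_expRM (- c) x.
have cexp x : {for x, continuous (fun y : R => expR (- c * y))}.
  apply: differentiable_continuous; apply/derivable1_diffP.
  exact: (@ex_derive _ _ _ _ _ _ _ (d x)).
have mexp : measurable_fun setT (fun y : R => expR (- c * y)).
  exact: continuous_measurable_fun.
rewrite (integral_itv_obnd_cbnd (f := fun y => (expR (- c * y))%:E)); last first.
  exact/measurable_EFinP/measurable_funTS.
have dF x : is_derive x 1 (fun y : R => - c^-1 * expR (- c * y)) (expR (- c * x)).
  have := @is_deriveM _ _ (cst (- c^-1)) (fun y : R => expR (- c * y)) x 1 0
    (- c * expR (- c * x)) _ _.
  rewrite /= scaler0 addr0 /GRing.scale/= mulrA mulrNN mulVf ?gt_eqF// mul1r.
  by move=> H; apply: H.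
rewrite (@ge0_continuous_FTC2y _ _ (fun y => - c^-1 * expR (- c * y)) 0 0).
- by rewrite mulr0 expR0 mulr1 -EFinB sub0r opprK.
- by move=> x _; exact: expR_ge0.
- exact: continuous_subspaceT.
- rewrite -(mulr0 (- c^-1)); apply: cvgM; first exact: cvg_cst.
  rewrite (_ : (fun x => expR (- c * x)) =
               (fun z => expR (- z)) \o (fun z => c * z)); last first.
    by apply: eq_fun => x; rewrite mulNr.
  apply: (@cvg_comp _ _ _ _ _ _ (pinfty_nbhs R)); last exact: cvgr_expR.
  exact: gt0_cvgMry.
- by move=> x _; exact: (@ex_derive _ _ _ _ _ _ _ (dF x)).
- apply/cvg_at_right_filter.
  suff : {for 0, continuous (fun y : R => - c^-1 * expR (- c * y))} by [].
  apply: differentiable_continuous; apply/derivable1_diffP.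
  exact: (@ex_derive _ _ _ _ _ _ _ (dF 0)).
- by move=> x _; rewrite derive1E (@derive_val _ _ _ _ _ _ _ (dF x)).
Qed.

Definition gkernel s x := x `^ (s - 1) * expR (- x).

Lemma gkernel_ge0 s x : 0 <= gkernel s x.
Proof. by rewrite mulr_ge0 ?powR_ge0 ?expR_ge0. Qed.

Lemma measurable_gkernel s (D : set R) : measurable_fun D (gkernel s).
Proof.
apply: measurable_funTS; apply: measurable_funM; first exact: measurable_powR.
by apply: measurableT_comp => //; exact: measurable_expR.
Qed.

(** Extended real values allow the functional equation to be proved before finiteness, which is then
    deduced from it. *)
Definition egamma s : \bar R := (\int[mu]_(x in `]0%R, +oo[) (gkernel s x)%:E)%E.

Lemma egamma_ge0 s : (0 <= egamma s)%E.
Proof. by apply: integral_ge0 => x _; rewrite lee_fin gkernel_ge0. Qed.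

Lemma continuous_gkernel s x : 0 < x -> {for x, continuous (gkernel s)}.
Proof.
move=> x0; apply: continuousM; first exact: continuous_powR.
apply: (@continuous_comp _ _ _ (@GRing.opp R) expR); first exact: opp_continuous.
exact: continuous_expR.
Qed.

Lemma is_derive_gkernel s x : 0 < x ->
  is_derive x 1 (gkernel (s + 1)) (s * gkernel s x - gkernel (s + 1) x).
Proof.
move=> x0; have d1 := is_derive_powR s x0.
have d2 : is_derive x 1 (fun y : R => expR (- y)) (- expR (- x)).
  have -> : (fun y : R => expR (- y)) = (fun y : R => expR (-1 * y)).
    by apply/funext => y; rewrite mulN1r.
  by have := @is_derive_expRM (-1) x; rewrite !mulN1r.
have := @is_deriveM _ _ (fun y : R => y `^ s) (fun y : R => expR (- y)) x 1 _ _ d1 d2.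
rewrite /GRing.scale/= /gkernel addrK => H.
rewrite (_ : _ - _ = x `^ s * - expR (- x) + expR (- x) * (s * x `^ (s - 1))) //.
by ring.
Qed.

(** Compact segments exhausting ]0, +oo[, on which the kernel is continuous; the shift by 2 keeps
    the two ends distinct. *)
Let seg (i : nat) : set R := `[i.+2%:R^-1, i.+2%:R]%classic.

Let segV_lt (i : nat) : i.+2%:R^-1 < i.+2%:R :> R.
Proof. by rewrite (@lt_trans _ _ 1) ?invf_lt1 ?ltr1n // ltr0n. Qed.

Let mseg (i : nat) : measurable (seg i : set (measurableTypeR R)).
Proof. exact: measurable_itv. Qed.

Let seg_nd : nondecreasing_seq seg.
Proof.
move=> i j ij; rewrite subsetEset; apply: subset_itv; rewrite bnd_simp.
  by rewrite lef_pV2 ?posrE // ler_nat !ltnS.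
by rewrite ler_nat !ltnS.
Qed.

Let seg_bigcup : \bigcup_i seg i = `]0%R, +oo[.
Proof.
apply/seteqP; split=> [x [i _]|x]; rewrite /seg /= !in_itv/= ?andbT.
  by move=> /andP[+ _]; apply: lt_le_trans; rewrite invr_gt0.
move=> x0; pose k := Num.truncn (x + x^-1).
have k1 : x + x^-1 < k.+1%:R by rewrite -truncn_lt_nat ?addr_ge0 ?invr_ge0 ?ltW.
exists k => //=; rewrite in_itv/= -[X in _ <= X]invrK lef_pV2 ?posrE ?invr_gt0 //.
have k2 : k.+1%:R <= k.+2%:R :> R by rewrite ler_nat.
apply/andP; split; apply: le_trans k2; apply/ltW; apply: le_lt_trans k1.
  by rewrite lerDr ltW.
by rewrite lerDl invr_ge0 ltW.
Qed.

Let cvg_seg s : (\int[mu]_(x in seg i) (gkernel s x)%:E)%E @[i --> \oo] --> egamma s.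
Proof.
rewrite /egamma -seg_bigcup.
apply: ge0_nondecreasing_set_cvg_integral => //.
- by move=> i; apply/measurable_EFinP; exact: measurable_gkernel.
- by move=> i x _; rewrite lee_fin gkernel_ge0.
Qed.

Let seg_cont s (i : nat) : {within seg i, continuous (gkernel s)}.
Proof.
apply: continuous_in_subspaceT => x; rewrite inE /seg /= in_itv/= => /andP[ix _].
by apply: continuous_gkernel; apply: lt_le_trans ix; rewrite invr_gt0.
Qed.

Let seg_integrable s (i : nat) : mu.-integrable (seg i) (EFin \o gkernel s).
Proof.
by apply: continuous_compact_integrable; [exact: segment_compact|exact: seg_cont].
Qed.

Let cvg_gkernel_end s : 0 < s ->
  gkernel (s + 1) (i.+2%:R^-1) - gkernel (s + 1) i.+2%:R @[i --> \oo] --> (0 : R).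
Proof.
move=> s0; rewrite -(subr0 0); apply: cvgB.
  apply: (@squeeze_cvgr _ _ _ _ (cst 0) (fun i => (i.+2%:R^-1) `^ s)).
  - near=> i; rewrite gkernel_ge0 /= /gkernel addrK.
    apply: ler_piMr; first exact: powR_ge0.
    by rewrite -expR0 ler_expR oppr_le0 invr_ge0.
  - exact: cvg_cst.
  - have /cvg_at_rightP := powR_cvg0 s0; apply; split.
      by move=> i; rewrite invr_gt0.
    by rewrite (cvg_shiftS (fun i => (i.+1%:R^-1 : R))); exact: cvg_harmonic.
apply: (@squeeze_cvgr _ _ _ _ (cst 0)
  (fun i => (2 * s) `^ s * expR (- (2^-1 * i.+2%:R)))).
- near=> i; rewrite gkernel_ge0 /= /gkernel addrK.
  have i0 : 0 < i.+2%:R :> R by rewrite ltr0n.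
  have := powR_le_expR s0 i0.
  move=> /(ler_wpM2r (expR_ge0 (- i.+2%:R))) /le_trans; apply.
  rewrite -mulrA -expRD; have -> : i.+2%:R / 2 - i.+2%:R = - (2^-1 * i.+2%:R) :> R.
    by field.
  exact: lexx.
- exact: cvg_cst.
- rewrite -(mulr0 ((2 * s) `^ s)); apply: cvgM; first exact: cvg_cst.
  apply: (@cvg_comp _ _ _ (fun i : nat => i.+2%:R)
    (fun y : R => expR (- (2^-1 * y))) _ (pinfty_nbhs R)).
    apply: (@cvg_comp _ _ _ (fun i => i.+2) (fun i => (i%:R : R)) _ \oo).
      by have := @cvg_addnr 2; under eq_fun do rewrite addn2.
    exact: cvgr_idn.
  apply: (@cvg_comp _ _ _ (fun y : R => 2^-1 * y) (fun y : R => expR (- y))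
    _ (pinfty_nbhs R)); last exact: cvgr_expR.
  by apply: gt0_cvgMry; [rewrite invr_gt0|exact: cvg_id].
Unshelve. all: by end_near. Qed.

(** Integration by parts on each segment: [gkernel (s + 1)] has derivative
    [s * gkernel s - gkernel (s + 1)], and its values at the two ends tend to 0. *)
Lemma egammaS s : 0 < s -> egamma (s + 1) = (s%:E * egamma s)%E.
Proof.
move=> s0.
have segE i : (\int[mu]_(x in seg i) (gkernel (s + 1) x)%:E =
    (gkernel (s + 1) (i.+2%:R^-1) - gkernel (s + 1) i.+2%:R)%:E +
    s%:E * \int[mu]_(x in seg i) (gkernel s x)%:E)%E.
  have segp x : x \in (`[i.+2%:R^-1, i.+2%:R])%R -> 0 < x :> R.
    by rewrite in_itv/= => /andP[+ _]; apply: lt_le_trans; rewrite invr_gt0.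
  have cF x : 0 < x -> {for x, continuous (gkernel (s + 1))}.
    exact: continuous_gkernel.
  have := @continuous_FTC2 R (fun x => s * gkernel s x - gkernel (s + 1) x)
    (gkernel (s + 1)) _ _ (segV_lt i) _ _ _.
  have int1 : mu.-integrable (seg i) (EFin \o (fun x => s * gkernel s x)).
    have H := integrableZl (mseg i) s (seg_integrable s i).
    by apply: (eq_integrable (mseg i) _ _ _ H) => x _; rewrite /= EFinM.
  have int2 := seg_integrable (s + 1) i.
  rewrite -/(seg i) integralB_EFin //.
  move=> FTC.
  have {}FTC : (\int[mu]_(x in seg i) (s * gkernel s x)%:E -
      \int[mu]_(x in seg i) (gkernel (s + 1) x)%:E =
      (gkernel (s + 1) i.+2%:R)%:E - (gkernel (s + 1) i.+2%:R^-1)%:E)%E.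
    apply: FTC.
    - move=> x; apply: cvgB; last exact: seg_cont.
      by apply: cvgM; [exact: cvg_cst|exact: seg_cont].
    - split.
      + move=> x xI; apply: (@ex_derive _ _ _ _ _ _ _ (is_derive_gkernel s _)).
        by apply: segp; apply: subset_itv_oo_cc xI.
      + apply: cvg_at_right_filter; apply: cF; by rewrite invr_gt0.
      + apply: cvg_at_left_filter; exact: cF.
    - move=> x xI; rewrite derive1E.
      apply: (@derive_val _ _ _ _ _ _ _ (is_derive_gkernel s _)).
      by apply: segp; apply: subset_itv_oo_cc xI.
  move: FTC.
  have -> : (\int[mu]_(x in seg i) (s * gkernel s x)%:E =
      s%:E * \int[mu]_(x in seg i) (gkernel s x)%:E)%E.
    under eq_integral do rewrite EFinM.
    exact: (integralZl (mseg i) (seg_integrable s i) s).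
  have /fineK <- := integrable_fin_num (mseg i) int2.
  have /fineK <- := integrable_fin_num (mseg i) (seg_integrable s i).
  rewrite -!EFinM -!EFinB -!EFinD /= => -[h]; congr (_%:E).
  by move/eqP: h; rewrite subr_eq => /eqP ->; ring.
have L : (\int[mu]_(x in seg i) (gkernel (s + 1) x)%:E)%E @[i --> \oo] -->
    (0%:E + s%:E * egamma s)%E.
  rewrite (eq_cvg _ _ segE); apply: cvgeD.
  - by rewrite fin_num_adde_defr.
  - by apply: cvg_EFin; [exact: nearW|exact: cvg_gkernel_end].
  - by apply: cvgeZl => //; exact: cvg_seg.
rewrite add0e in L; have C := @cvg_seg (s + 1).
by rewrite -(cvg_lim _ L) // (cvg_lim _ C).
Qed.

End GammaFunction.

Section GammaReal.
Context {R : realType}.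
Notation mu := (@lebesgue_measure R).
Implicit Types (x s p c : R).

Let D : set R := `]0%R, +oo[.

Let mD : measurable (D : set (measurableTypeR R)).
Proof. exact: measurable_itv. Qed.

Let D_gt0 x : D x -> 0 < x.
Proof. by rewrite /D /= in_itv/= andbT. Qed.

Lemma egamma_fin s : 0 < s -> egamma s \is a fin_num.
Proof.
(* At s + 1 the kernel has no singularity at 0 and lies below a multiple of exp(- x / 2); the
   functional equation then carries finiteness down to s. *)
move=> s0; have fin1 : egamma (s + 1) \is a fin_num.
  rewrite ge0_fin_numE ?egamma_ge0 //.
  have mexp : measurable_fun D (fun y : R => expR (- 2^-1 * y)).
    apply: measurable_funTS; apply: measurableT_comp; first exact: measurable_expR.
    exact: mulrl_measurable.
  apply: (@le_lt_trans _ _ (\int[mu]_(x in D)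
      (((2 * s) `^ s)%:E * (expR (- 2^-1 * x))%:E))%E).
    apply: ge0_le_integral => //.
    - by move=> x _; rewrite lee_fin gkernel_ge0.
    - by apply/measurable_EFinP; exact: measurable_gkernel.
    - by apply/measurable_EFinP; apply: measurable_funM.
    - move=> x /D_gt0 x0; rewrite -EFinM lee_fin /gkernel addrK.
      have := powR_le_expR s0 x0.
      move=> /(ler_wpM2r (expR_ge0 (- x))) /le_trans; apply.
      rewrite -mulrA -expRD (_ : x / 2 - x = - 2^-1 * x) //; by field.
  rewrite ge0_integralZl_EFin ?powR_ge0 //.
  - by rewrite integral_expRN ?invr_gt0 // -EFinM ltry.
  - exact/measurable_EFinP.
move: fin1; rewrite egammaS //; case: (egamma s) => //.
  by rewrite mulry gtr0_sg // mul1e.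
by rewrite mulrNy gtr0_sg // mul1e.
Qed.

Lemma EFin_Gamma s : 0 < s -> (Gamma s)%:E = egamma s.
Proof. by move=> s0; rewrite /Gamma /Rintegral fineK //; exact: egamma_fin. Qed.

Lemma integrable_gkernel s : 0 < s -> mu.-integrable D (EFin \o gkernel s).
Proof.
move=> s0; apply/integrableP; split.
  by apply/measurable_EFinP; exact: measurable_gkernel.
have := egamma_fin s0; rewrite ge0_fin_numE ?egamma_ge0 //.
apply: le_lt_trans; rewrite le_eqVlt; apply/orP; left; apply/eqP.
by apply: eq_integral => x _; rewrite /= ger0_norm // gkernel_ge0.
Qed.

Lemma GammaS s : 0 < s -> Gamma (s + 1) = s * Gamma s.
Proof.
move=> s0; apply: EFin_inj; rewrite EFinM !EFin_Gamma ?egammaS //.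
by rewrite addr_gt0.
Qed.

Lemma Gamma1 : Gamma 1 = 1 :> R.
Proof.
apply: EFin_inj; rewrite EFin_Gamma // -[X in _ = X%:E]invr1 -integral_expRN //.
by apply: eq_integral => x _; rewrite /gkernel subrr powRr0 mul1r mulN1r.
Qed.

Lemma Gamma_rfact s k : 0 < s -> Gamma (s + k%:R) = rfact s k * Gamma s.
Proof.
move=> s0; elim: k => [|k IHk]; first by rewrite addr0 rfact0 mul1r.
rewrite -natr1 addrA GammaS ?IHk ?rfactS; first by ring.
by rewrite ltr_wpDr.
Qed.

Lemma Gamma_fact k : Gamma k.+1%:R = k`!%:R :> R.
Proof.
rewrite -nat1r Gamma_rfact // Gamma1 mulr1 /rfact.
elim: k => [|k IHk]; first by rewrite big_ord0.
by rewrite big_ord_recr /= IHk factS natrM nat1r mulrC.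
Qed.

(** For x = exp L, take exp y >= 1 + y at y = (1 - p) L and at y = - p L, with weights p and 1 - p:
    the linear terms cancel, and multiplying by exp (p L) gives the claim. *)
Lemma powR_bernoulli p x : 0 <= p -> p <= 1 -> 0 < x -> x `^ p <= 1 - p + p * x.
Proof.
move=> p0 p1 x0; have q0 : 0 <= 1 - p by rewrite subr_ge0.
rewrite -(lnK x0) /powR gt_eqF ?expR_gt0 // expRK; set L := ln x.
have e1 : expR L = expR (p * L) * expR ((1 - p) * L).
  by rewrite -expRD -mulrDl subrKC mul1r.
have e2 : expR (p * L) * expR (- (p * L)) = 1 by rewrite -expRD subrr expR0.
have h1 := ler_wpM2l p0 (expR_ge1Dx ((1 - p) * L)).
have h2 := ler_wpM2l q0 (expR_ge1Dx (- (p * L))).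
have := ler_wpM2l (expR_ge0 (p * L)) (lerD h1 h2).
have -> : p * (1 + (1 - p) * L) + (1 - p) * (1 + - (p * L)) = 1 by ring.
rewrite mulr1 => /le_trans; apply.
rewrite e1 (_ : _ * (_ + _) = p * (expR (p * L) * expR ((1 - p) * L)) +
  (1 - p) * (expR (p * L) * expR (- (p * L)))); last by ring.
by rewrite e2 mulr1 addrC.
Qed.

(* Integrate x^p <= s^p (1 - p + p x / s), which is Bernoulli's inequality. *)
Lemma Gamma_log_convex s p : 0 < s -> 0 < p -> p < 1 ->
  Gamma (s + p) <= s `^ p * Gamma s.
Proof.
move=> s0 p0 p1; have sp0 : 0 < s + p by rewrite addr_gt0.
have s10 : 0 < s + 1 by rewrite addr_gt0.
have i1 : mu.-integrable D (EFin \o (fun x => s `^ p * (1 - p) * gkernel s x)).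
  have H := integrableZl mD (s `^ p * (1 - p)) (integrable_gkernel s0).
  by apply: (eq_integrable mD _ _ _ H) => x _; rewrite /= EFinM.
have i2 : mu.-integrable D (EFin \o (fun x => s `^ p * (p / s) * gkernel (s + 1) x)).
  have H := integrableZl mD (s `^ p * (p / s)) (integrable_gkernel s10).
  by apply: (eq_integrable mD _ _ _ H) => x _; rewrite /= EFinM.
have -> : s `^ p * Gamma s = \int[mu]_(x in D)
    (s `^ p * (1 - p) * gkernel s x + s `^ p * (p / s) * gkernel (s + 1) x).
  rewrite RintegralD // !RintegralZl //; try exact: integrable_gkernel.
  rewrite -/(Gamma s) -/(Gamma (s + 1)) GammaS //.
  by field; rewrite gt_eqF.
apply: le_Rintegral => //; first exact: integrable_gkernel.
  have H := integrableD mD i1 i2.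
  by apply: (eq_integrable mD _ _ _ H) => x _; rewrite /= EFinD.
move=> x /D_gt0 x0; rewrite -/(gkernel (s + p) x) /gkernel.
have -> : s + p - 1 = (s - 1) + p by ring.
have -> : s + 1 - 1 = (s - 1) + 1 by ring.
move: (s - 1) => r.
rewrite !powRD ?(gt_eqF x0) ?implybT // powRr1 ?(ltW x0) //.
have xs0 : 0 < x / s by rewrite divr_gt0.
have := powR_bernoulli (ltW p0) (ltW p1) xs0.
move=> /(ler_wpM2l (powR_ge0 s p)).
rewrite -powRM ?(ltW s0) ?(ltW xs0) //.
rewrite (_ : s * (x / s) = x); last by field; rewrite gt_eqF.
have k0 : 0 <= x `^ r * expR (- x) by rewrite mulr_ge0 ?powR_ge0 ?expR_ge0.
move=> /(ler_wpM2l k0) h.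
rewrite (_ : x `^ r * x `^ p * expR (- x) =
  x `^ r * expR (- x) * x `^ p); last by ring.
apply: (le_trans h); rewrite le_eqVlt; apply/orP; left; apply/eqP. ring.
Qed.

(** Log-convexity with step 1 - s yields 1 = Gamma 1 <= s^(1 - s) Gamma s. *)
Lemma Gamma_gt0 s : 0 < s -> s < 1 -> 0 < Gamma s.
Proof.
move=> s0 s1; have := @Gamma_log_convex s (1 - s) s0.
rewrite subr_gt0 s1 gtrBl s0 subrKC Gamma1 => /(_ isT isT) h.
rewrite -(pmulr_rgt0 _ (powR_gt0 (1 - s) s0)).
exact: lt_le_trans h.
Qed.

(** Normalised so as to be asymptotic to k^(s - 1) with constant 1; it equals Gamma (s + k) / k!. *)
Definition gcf s k : R := Gamma s * cf s k.

Lemma gcf_ge0 s k : 0 < s -> s < 1 -> 0 <= gcf s k.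
Proof. by move=> s0 s1; rewrite mulr_ge0 ?cf_ge0 ?ltW // Gamma_gt0. Qed.

Lemma gcfE s k : 0 < s -> gcf s k = Gamma (s + k%:R) / k`!%:R.
Proof. by move=> s0; rewrite Gamma_rfact // /gcf /cf; ring. Qed.

Lemma ler_powR_le0 s x y : s <= 0 -> 0 < x -> x <= y -> y `^ s <= x `^ s.
Proof.
move=> s0 x0 xy; have y0 := lt_le_trans x0 xy.
rewrite -(opprK s) !(powRN _ (- s)) lef_pV2 ?posrE ?powR_gt0 //.
by apply: ge0_ler_powR; rewrite ?nnegrE ?oppr_ge0 ?(ltW x0) ?(ltW y0).
Qed.

(** Log-convexity from k with step s: Gamma (k + s) <= k^s (k - 1)!. *)
Lemma gcf_le s k : 0 < s -> s < 1 -> (0 < k)%N -> gcf s k <= k%:R `^ (s - 1).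
Proof.
case: k => // k s0 s1 _; have k0 : 0 < k.+1%:R :> R by rewrite ltr0n.
have f0 m : 0 < m`!%:R :> R by rewrite ltr0n fact_gt0.
rewrite gcfE // ler_pdivrMr // addrC.
apply: (le_trans (Gamma_log_convex k0 s0 s1)).
rewrite Gamma_fact factS natrM mulrA ler_pM2r //.
by rewrite [leRHS]mulrC mulr_powRB1 ?(ltW k0).
Qed.

(** Log-convexity from k + s with step 1 - s: k! <= (k + s)^(1 - s) Gamma (k + s). *)
Lemma gcf_ge s k : 0 < s -> s < 1 -> (k%:R + s) `^ (s - 1) <= gcf s k.
Proof.
move=> s0 s1; have ks0 : 0 < k%:R + s by rewrite ltr_wpDl.
have f0 m : 0 < m`!%:R :> R by rewrite ltr0n fact_gt0.
rewrite gcfE // ler_pdivlMr //.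
have := @Gamma_log_convex (k%:R + s) (1 - s) ks0.
rewrite subr_gt0 s1 gtrBl s0 => /(_ isT isT).
rewrite -addrA subrKC natr1 Gamma_fact => h.
rewrite -(opprB 1 s) powRN mulrC ler_pdivrMr ?powR_gt0 //.
by rewrite mulrC [s + _]addrC.
Qed.

(** Shifting the base to k + 1 includes k = 0, where the value is Gamma s; for k > 0 the shift costs
    at most 2^(1 - s) <= 2. *)
Lemma gcf_bound s k : 0 < s -> s < 1 ->
  gcf s k <= (Gamma s + 2) * k.+1%:R `^ (s - 1).
Proof.
move=> s0 s1; have G0 := Gamma_gt0 s0 s1.
case: k => [|k]; first by rewrite /gcf cf0 powR1 !mulr1 lerDl.
apply: (le_trans (gcf_le s0 s1 (ltn0Sn k))).
have k0 : 0 < k.+2%:R / 2 :> R by rewrite divr_gt0.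
have sN : s - 1 <= 0 by rewrite subr_le0 ltW.
apply: (@le_trans _ _ ((k.+2%:R / 2) `^ (s - 1))).
  apply: ler_powR_le0 => //.
  rewrite ler_pdivrMr // -natrM ler_nat; lia.
rewrite powRM ?invr_ge0 // mulrC ler_wpM2r ?powR_ge0 //.
have -> : (2^-1 : R) `^ (s - 1) = 2 `^ (1 - s).
  by rewrite -(powR_inv1 (ler0n R 2)) -powRrM mulN1r opprB.
apply: (@le_trans _ _ (2 `^ 1)).
  by apply: ler_powR; [rewrite ler1n|rewrite gerBl ltW].
by rewrite powRr1 // lerDr ltW.
Qed.

(** The partial sum of [cf s] is [cf (s + 1) n], that is (s + n) [cf s n] / s, so a bound on one
    coefficient suffices. *)
Lemma gcf_partial_sum s : 0 < s -> s < 1 -> exists2 C, 0 <= C &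
  forall n, (0 < n)%N -> \sum_(k < n.+1) gcf s k <= C * n%:R `^ s.
Proof.
move=> s0 s1; have G0 := Gamma_gt0 s0 s1.
exists ((Gamma s + 2) * 2 / s); first by rewrite divr_ge0 ?mulr_ge0 ?addr_ge0 ?ltW.
move=> n n0; have n0' : 0 < n%:R :> R by rewrite ltr0n.
rewrite -mulr_sumr cf_partial_sum.
have -> : cf (s + 1) n = (s + n%:R) * cf s n / s.
  by rewrite -cf_shift; field; rewrite gt_eqF.
rewrite (_ : _ * (_ / s) = gcf s n * (s + n%:R) / s); last by rewrite /gcf; ring.
rewrite [leRHS]mulrAC ler_pM2r ?invr_gt0 //.
have h : s + n%:R <= n.+1%:R by rewrite -nat1r lerD2r ltW.
apply: (@le_trans _ _ ((Gamma s + 2) * n.+1%:R `^ (s - 1) * n.+1%:R)).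
  by apply: ler_pM; rewrite ?gcf_ge0 ?gcf_bound // addr_ge0 // ltW.
rewrite -mulrA [_ `^ _ * _]mulrC mulr_powRB1 // -mulrA ler_wpM2l ?addr_ge0 ?(ltW G0) //.
apply: (@le_trans _ _ ((2 * n%:R) `^ s)).
  apply: ge0_ler_powR; rewrite ?nnegrE ?(ltW s0) ?mulr_ge0 //.
  rewrite -natrM ler_nat; lia.
rewrite powRM // ler_wpM2r ?powR_ge0 //.
have := @ler_powR R 2 _ s 1; rewrite powRr1 // => -> //; last exact: ltW.
by rewrite ler1n.
Qed.

Lemma cvg_gcf s x (k : nat -> nat) : 0 < s -> s < 1 -> 0 < x ->
  (k n)%:R / n%:R @[n --> \oo] --> x ->
  n%:R `^ (1 - s) * gcf s (k n) @[n --> \oo] --> x `^ (s - 1).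
Proof.
move=> s0 s1 x0 kx.
have cx := @continuous_powR R (s - 1) x x0.
have kpos : \forall n \near \oo, (0 < k n)%N /\ (0 < n)%N.
  have x2 : 0 < x / 2 by rewrite divr_gt0.
  have /cvgrPdist_lt /(_ _ x0) [N _ HN] := kx; exists N.+1 => // n /= Nn.
  have n0 : (0 < n)%N by lia.
  split => //; rewrite lt0n; apply/eqP => k0.
  have := HN n (ltnW Nn); rewrite /= k0 mul0r subr0 gtr0_norm //.
  by rewrite ltxx.
have powE (y : R) n : 0 <= y -> (0 < n)%N ->
    n%:R `^ (1 - s) * y `^ (s - 1) = (y / n%:R) `^ (s - 1).
  move=> y0 n0; rewrite powRM ?invr_ge0 // mulrC; congr (_ * _).
  by rewrite -(powR_inv1 (ler0n R n)) -powRrM mulN1r opprB.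
apply: (@squeeze_cvgr _ _ _ _ (fun n => (((k n)%:R + s) / n%:R) `^ (s - 1))
  (fun n => ((k n)%:R / n%:R) `^ (s - 1))).
- near=> n.
  have [k0 n0] : (0 < k n)%N /\ (0 < n)%N by near: n.
  rewrite -!powE ?addr_ge0 ?(ltW s0) // !ler_wpM2l ?powR_ge0 ?gcf_ge //.
  exact: gcf_le.
- have L : ((k n)%:R + s) / n%:R @[n --> \oo] --> x.
    under eq_fun do rewrite mulrDl.
    rewrite -[x]addr0; apply: cvgD => //.
    rewrite -(mulr0 s); apply: cvgM; first exact: cvg_cst.
    by rewrite -(cvg_shiftS (fun n => (n%:R^-1 : R))); exact: cvg_harmonic.
  exact: (@cvg_comp _ _ _ _ _ _ _ _ L cx).
- exact: (@cvg_comp _ _ _ _ _ _ _ _ kx cx).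
Unshelve. all: by end_near. Qed.

End GammaReal.

(** * Riemann sums with weights gcf *)

Section StepFunction.
Context {R : realType}.
Notation mu := (@lebesgue_measure R).
Variables (a : nat -> R) (T N : nat).
Hypotheses (a_ge0 : forall k, 0 <= a k) (N_gt0 : (0 < N)%N).

Let cell (k : nat) : set R := `[k%:R / N%:R, k.+1%:R / N%:R[.

Definition step_fun (x : R) := \sum_(k < T) a k * \1_(cell k) x.

Let N0 : 0 < N%:R :> R. Proof. by rewrite ltr0n. Qed.

Let mcell k : measurable (cell k : set (measurableTypeR R)).
Proof. exact: measurable_itv. Qed.

Lemma measurable_step_fun (D : set (measurableTypeR R)) :
  measurable_fun D step_fun.
Proof.
apply: measurable_sum => k; apply: measurable_funM; first exact: measurable_cst.
exact: measurable_indic.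
Qed.

Lemma step_funE x : 0 <= x ->
  step_fun x = if (Num.truncn (N%:R * x) < T)%N
               then a (Num.truncn (N%:R * x)) else 0.
Proof.
move=> x0; have Nx0 : 0 <= N%:R * x by rewrite mulr_ge0 ?(ltW N0).
have cellE (k : nat) :
    \1_(cell k) x = (k == Num.truncn (N%:R * x))%:R :> R.
  rewrite indicE; congr (nat_of_bool _)%:R; rewrite eq_sym truncn_eq //.
  by apply/idP/idP; rewrite inE /cell /= in_itv/= ler_pdivrMr // ltr_pdivlMr // mulrC.
rewrite /step_fun.
rewrite (eq_bigr (fun k : 'I_T => a k * (k == Num.truncn (N%:R * x) :> nat)%:R));
  last by move=> k _; rewrite cellE.
case: ifPn => [kT|kT].
  rewrite (bigD1 (Ordinal kT)) //= eqxx mulr1 big1 ?addr0 // => k kN.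
  rewrite (_ : (_ == _) = false) ?mulr0 //; apply/eqP => kE.
  by case/eqP: kN; apply: val_inj.
rewrite big1 // => k _; rewrite (_ : (_ == _) = false) ?mulr0 //.
by apply/eqP => kE; move: kT; rewrite -kE ltn_ord.
Qed.

Lemma integral_step_fun :
  (\int[mu]_(x in `]0%R, +oo[) (step_fun x)%:E = (\sum_(k < T) a k / N%:R)%:E)%E.
Proof.
rewrite (integral_itv_obnd_cbnd (f := fun x => (step_fun x)%:E)); last first.
  by apply/measurable_EFinP; exact: measurable_step_fun.
under eq_integral do rewrite /step_fun -sumEFin.
set D : set R := `[0%R, +oo[.
have mD : measurable (D : set (measurableTypeR R)) by exact: measurable_itv.
rewrite (@ge0_integral_sum _ _ _ _ _ mD _ (fun (k : 'I_T) x =>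
   (a k * \1_(cell k) x)%:E)).
- rewrite -sumEFin; apply: eq_bigr => k _.
  under eq_integral do rewrite EFinM.
  rewrite ge0_integralZl_EFin //.
  + rewrite integral_indic //.
    rewrite (_ : cell k `&` D = cell k); last first.
      apply/setIidl => x; rewrite /cell /D /= !in_itv/= andbT => /andP[+ _].
      by apply: le_trans; rewrite divr_ge0 ?(ltW N0).
    rewrite /= /cell lebesgue_measure_itv /= lte_fin ltr_pM2r ?invr_gt0 // ltr_nat ltnSn.
    rewrite -EFinB -EFinM -mulrBl -natrB // subSnn mul1r.
    by [].
  + by apply/measurable_EFinP; exact: measurable_indic.
- move=> k; apply/measurable_EFinP; apply: measurable_funM.
    exact: measurable_cst.
  exact: measurable_indic.
- by move=> k x _; rewrite lee_fin mulr_ge0.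
Qed.

End StepFunction.

Section RiemannSum.
Context {R : realType}.
Notation mu := (@lebesgue_measure R).
(** One step of the iterated limit, applied to each of the nested sums and to the beta law. F is
    kept apart from x^(s - 1) H because [Ifun] and [beta_df] write such weights as inverse powers,
    which need agree with it only inside ]0, tau[. *)
Variables (s tau M : R) (T : nat -> nat) (h : nat -> nat -> R) (H F : R -> R).
Hypotheses (s_gt0 : 0 < s) (s_lt1 : s < 1).
Hypothesis h_ge0 : forall n k, 0 <= h n k.
Hypothesis cvg_T : (T n)%:R / n%:R @[n --> \oo] --> tau.
Hypothesis h_le : \forall n \near \oo, forall k, (k < T n)%N -> h n k <= M.
Hypothesis cvg_h : forall x, 0 < x -> x < tau ->
  h n (Num.truncn (n%:R * x)) @[n --> \oo] --> H x.
Hypothesis FE : forall x, 0 < x -> x < tau -> F x = x `^ (s - 1) * H x.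

Let D : set R := `]0%R, +oo[.
Let E : set R := D `\ tau.

Let mE : measurable (E : set (measurableTypeR R)).
Proof. apply: (@measurableD _ (measurableTypeR R)); first exact: measurable_itv.
exact: measurable_set1. Qed.

Let a n k := n%:R `^ (1 - s) * gcf s k * h n k.

Let phi n := step_fun (a n) (T n) n.

Let f x := if x < tau then F x else 0.

Let a_ge0 n k : 0 <= a n k.
Proof.
apply: mulr_ge0 => //; apply: mulr_ge0; [exact: powR_ge0|exact: gcf_ge0].
Qed.

Lemma cvg_truncn_div (x : R) : 0 <= x ->
  (Num.truncn (n%:R * x))%:R / n%:R @[n --> \oo] --> x.
Proof.
move=> x0; apply: (@squeeze_cvgr _ _ _ _ (fun n => x - n%:R^-1) (cst x)).
- near=> n; have n0 : 0 < n%:R :> R by rewrite ltr0n; near: n; exact: nbhs_infty_gt.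
  have := @truncn_itv R (n%:R * x); rewrite mulr_ge0 ?(ltW n0) // => /(_ isT).
  move=> /andP[t1 t2]; apply/andP; split; last first.
    by rewrite ler_pdivrMr // [leRHS]mulrC.
  rewrite ler_pdivlMr // mulrBl mulVf ?gt_eqF // lerBlDr natr1 mulrC.
  exact: ltW.
- rewrite -[X in _ --> X]subr0; apply: cvgB; first exact: cvg_cst.
  by rewrite -(cvg_shiftS (fun n => (n%:R^-1 : R))); exact: cvg_harmonic.
- exact: cvg_cst.
Unshelve. all: by end_near. Qed.

Let cvg_phi x : E x -> phi n x @[n --> \oo] --> f x.
Proof.
move=> [/=]; rewrite /D /= in_itv/= andbT => x0 /eqP xtau.
have [xt|tx|/eqP] := ltgtP x tau; last by rewrite (negbTE xtau).
- rewrite /f xt FE //.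
  have : a n (Num.truncn (n%:R * x)) @[n --> \oo] --> x `^ (s - 1) * H x.
    apply: cvgM; last exact: cvg_h.
    by apply: cvg_gcf => //; apply: cvg_truncn_div; exact: ltW.
  apply: cvg_trans; apply: near_eq_cvg; near=> n.
  have n0 : (0 < n)%N by near: n; exact: nbhs_infty_gt.
  rewrite /phi step_funE ?(ltW x0) // ifT //.
  have xT : x < (T n)%:R / n%:R by near: n; exact: (cvgr_gt _ cvg_T).
  rewrite truncn_lt_nat ?mulr_ge0 ?(ltW x0) // mulrC -ltr_pdivlMr ?ltr0n //.
- rewrite /f ltNge (ltW tx) /=.
  have : (fun=> 0 : R) @ \oo --> (0 : R) by exact: cvg_cst.
  apply: cvg_trans; apply: near_eq_cvg; near=> n.
  have n0 : (0 < n)%N by near: n; exact: nbhs_infty_gt.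
  rewrite /phi step_funE ?(ltW x0) // ifN //.
  have Tx : (T n)%:R / n%:R < x by near: n; exact: (cvgr_lt _ cvg_T).
  rewrite truncn_lt_nat ?mulr_ge0 ?(ltW x0) // -leNgt mulrC -ler_pdivrMr ?ltr0n //.
  exact: ltW.
Unshelve. all: by end_near. Qed.

(** For large n the step function vanishes beyond tau + 1, and up to there 1 <= exp(tau + 1) exp(-
    x); this makes the integrable [gkernel s] a majorant. *)
Let K := (Gamma s + 2) * `|M| * expR (tau + 1).

Let phi_le : \forall n \near \oo, forall x, E x -> `|phi n x| <= K * gkernel s x.
Proof.
near=> n; have n0 : (0 < n)%N by near: n; exact: nbhs_infty_gt.
have hM : forall k, (k < T n)%N -> h n k <= M by near: n.
have Ttau : (T n)%:R / n%:R < tau + 1.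
  by near: n; apply: (cvgr_lt _ cvg_T); rewrite ltrDl.
have G0 : 0 < Gamma s by exact: Gamma_gt0.
move=> x [/=]; rewrite /D /= in_itv/= andbT => x0 _.
have K0 : 0 <= K by rewrite !mulr_ge0 ?addr_ge0 ?expR_ge0 ?(ltW G0).
have n0' : 0 < n%:R :> R by rewrite ltr0n.
rewrite /phi step_funE ?(ltW x0) //; case: ifPn => kT; last first.
  by rewrite normr0 mulr_ge0 ?gkernel_ge0.
set k := Num.truncn _ in kT *.
rewrite ger0_norm // /a.
have xk : x <= k.+1%:R / n%:R.
  rewrite ler_pdivlMr // mulrC; apply/ltW; rewrite -truncn_lt_nat //.
  by rewrite mulr_ge0 ?(ltW x0).
have xtau : x <= tau + 1.
  apply: (le_trans xk); apply: le_trans (ltW Ttau).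
  by rewrite ler_pM2r ?invr_gt0 // ler_nat.
have sN : s - 1 <= 0 by rewrite subr_le0 ltW.
have e1 : n%:R `^ (1 - s) * gcf s k <= (Gamma s + 2) * x `^ (s - 1).
  apply: (@le_trans _ _ (n%:R `^ (1 - s) * ((Gamma s + 2) * k.+1%:R `^ (s - 1)))).
    by rewrite ler_wpM2l ?powR_ge0 ?gcf_bound.
  rewrite mulrCA ler_wpM2l ?addr_ge0 ?(ltW G0) //.
  apply: le_trans (ler_powR_le0 sN x0 xk).
  rewrite powRM ?invr_ge0 // mulrC.
  by rewrite -(powR_inv1 (ler0n R n)) -powRrM mulN1r opprB.
have e2 : h n k <= `|M| by apply: le_trans (ler_norm M); exact: hM.
have e3 : 1 <= expR (tau + 1) * expR (- x).
  by rewrite -expRD -[leLHS]expR0 ler_expR subr_ge0.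
apply: (@le_trans _ _ ((Gamma s + 2) * x `^ (s - 1) * `|M|)).
  apply: ler_pM => //; apply: mulr_ge0; [exact: powR_ge0|exact: gcf_ge0].
rewrite (_ : K * gkernel s x = (Gamma s + 2) * x `^ (s - 1) * `|M| *
   (expR (tau + 1) * expR (- x))); last by rewrite /K /gkernel; ring.
by rewrite ler_peMr // !mulr_ge0 ?powR_ge0 ?addr_ge0 ?(ltW G0).
Unshelve. all: by end_near. Qed.

Let dct : mu.-integrable E (EFin \o f) /\
  (\int[mu]_(x in E) (phi n x)%:E)%E @[n --> \oo] --> (\int[mu]_(x in E) (f x)%:E)%E.
Proof.
(* The majorant is valid from N on only, whereas the theorem asks for it at every index; hence the
   shifted sequence. *)
have [N _ HN] := phi_le.
have mphi n : measurable_fun E (phi n) by exact: measurable_step_fun.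
have sub (x : R) : E x -> (fun n => phi (n + N)%N x) @ \oo --> f x.
  by move=> Ex; rewrite (cvg_shiftn N (fun n => phi n x)); exact: cvg_phi.
have [] := @dominated_convergence _ _ R mu E mE
  (fun n x => (phi (n + N)%N x)%:E) (EFin \o f) (EFin \o (fun x => K * gkernel s x)).
- by move=> n; apply/measurable_EFinP; exact: mphi.
- apply/measurable_EFinP.
  by apply: (@measurable_fun_cvg _ _ _ _ (fun n => phi (n + N)%N)).
- apply: aeW => x Ex; apply: cvg_EFin; first exact: nearW.
  exact: sub.
- have I1 : mu.-integrable E (EFin \o gkernel s).
    apply: (integrableS _ mE _ (integrable_gkernel s_gt0)).
      exact: measurable_itv.
    exact: subDsetl.
  have I2 := integrableZl mE K I1.
  by apply: (eq_integrable mE _ _ _ I2) => x _; rewrite /= EFinM.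
- apply: aeW => x n Ex /=; rewrite lee_fin; apply: HN => //=.
  exact: leq_addl.
move=> If _ C; split => //.
by rewrite -(cvg_shiftn N (fun n => (\int[mu]_(x in E) (phi n x)%:E)%E)).
Qed.

Let I := `]0%R, tau[ : set R.

Let mI : measurable (I : set (measurableTypeR R)).
Proof. exact: measurable_itv. Qed.

Let IE : I `<=` E.
Proof.
move=> x; rewrite /I /E /D /= !in_itv/= => /andP[x0 xt]; split.
  by rewrite x0.
by move=> xtau; move: xt; rewrite xtau ltxx.
Qed.

Lemma riemann_sum_integrable : mu.-integrable `]0%R, tau[ (EFin \o F).
Proof.
have := integrableS mE mI IE dct.1.
apply: eq_integrable => // x; rewrite inE /I /= in_itv/= => /andP[_ xt].
by rewrite /f xt.
Qed.

(* Dominated convergence for a step function with cells [k/n, (k+1)/n[: gcf_bound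
   gives the majorant K x^(s-1) exp(-x). The point tau is removed so that the
   convergence holds everywhere. *)
Lemma cvg_riemann_sum :
  (\sum_(k < T n) gcf s k * h n k) / n%:R `^ s @[n --> \oo] -->
  \int[mu]_(x in `[0, tau]) F x.
Proof.
have mF : measurable_fun I F.
  apply/measurable_EFinP; exact: (measurable_int mu riemann_sum_integrable).
have EF : (\int[mu]_(x in E) (f x)%:E = (\int[mu]_(x in `[0, tau]) F x)%:E)%E.
  rewrite /Rintegral fineK; last first.
    rewrite integral_itv_bndoo; last exact/measurable_EFinP.
    exact: (integrable_fin_num mI riemann_sum_integrable).
  rewrite integral_itv_bndoo; last exact/measurable_EFinP.
  rewrite -/I -[in RHS](setIidr IE) [RHS]integral_mkcondr.
  apply: eq_integral => x; rewrite inE => -[].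
  rewrite /D /= in_itv/= andbT => x0 _; rewrite /f patchE /I.
  case: ifPn => xt; first by rewrite ifT // inE /= in_itv/= x0.
  by rewrite ifN // notin_setE /= in_itv/= (negbTE xt) andbF.
have := dct.2; rewrite EF.
have phiE n : (0 < n)%N -> (\int[mu]_(x in E) (phi n x)%:E)%E =
    ((\sum_(k < T n) gcf s k * h n k) / n%:R `^ s)%:E.
  move=> n0; rewrite integral_setD1.
  - rewrite integral_step_fun // mulr_suml; congr (_%:E); apply: eq_bigr => k _.
    have n0' : 0 < n%:R :> R by rewrite ltr0n.
    (* The factor n^(1 - s) times the cell width 1 / n is n^(- s). *)
    rewrite /a powRB ?(gt_eqF n0') ?implybT // powRr1 ?(ltW n0') //.
    by field; rewrite !gt_eqF // powR_gt0.
  - exact: mE.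
  - by apply/measurable_EFinP; exact: measurable_step_fun.
move=> C.
have {}C : (fun n => ((\sum_(k < T n) gcf s k * h n k) / n%:R `^ s)%:E) @ \oo -->
  (\int[mu]_(x in `[0, tau]) F x)%:E.
  apply: cvg_trans C; apply: near_eq_cvg; near=> n.
  by rewrite phiE //; near: n; exact: nbhs_infty_gt.
by have /fine_cvgP[_] := C.
Unshelve. all: by end_near. Qed.

End RiemannSum.

(** * Limit of the triple sum *)

Section NatRatios.
Context {R : realType}.
Implicit Types (k j : nat -> nat) (x y : R).

Lemma cvg_ratio_add k j x y :
  (k n)%:R / n%:R @[n --> \oo] --> x -> (j n)%:R / n%:R @[n --> \oo] --> y ->
  (k n + j n)%N%:R / n%:R @[n --> \oo] --> x + y.
Proof.
by move=> kx jy; under eq_fun do rewrite natrD mulrDl; exact: cvgD.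
Qed.

(** The strict inequality makes j n < k n eventually, with (x + y) / 2 separating the ratios, so
    truncated subtraction agrees with the real one. *)
Lemma cvg_ratio_sub k j x y : y < x ->
  (k n)%:R / n%:R @[n --> \oo] --> x -> (j n)%:R / n%:R @[n --> \oo] --> y ->
  (k n - j n)%N%:R / n%:R @[n --> \oo] --> x - y.
Proof.
move=> yx kx jy.
have : (k n)%:R / n%:R - (j n)%:R / n%:R @[n --> \oo] --> x - y by exact: cvgB.
apply: cvg_trans; apply: near_eq_cvg; near=> n.
have n0 : 0 < n%:R :> R by rewrite ltr0n; near: n; exact: nbhs_infty_gt.
have h1 : (j n)%:R / n%:R < (x + y) / 2.
  by near: n; apply: (cvgr_lt _ jy); rewrite ltr_pdivlMr //; lra.
have h2 : (x + y) / 2 < (k n)%:R / n%:R.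
  by near: n; apply: (cvgr_gt _ kx); rewrite ltr_pdivrMr //; lra.
have := lt_trans h1 h2; rewrite ltr_pM2r ?invr_gt0 // ltr_nat => jk.
by rewrite natrB ?mulrBl // ltnW.
Unshelve. all: by end_near. Qed.

Lemma cvg_ratio_id : n%:R / n%:R @[n --> \oo] --> (1 : R).
Proof.
have : (fun=> 1 : R) @ \oo --> (1 : R) by exact: cvg_cst.
apply: cvg_trans; apply: near_eq_cvg; near=> n.
by rewrite divff // pnatr_eq0 -lt0n; near: n; exact: nbhs_infty_gt.
Unshelve. all: by end_near. Qed.

Lemma cvg_ratio_cst (c : nat) : c%:R / n%:R @[n --> \oo] --> (0 : R).
Proof.
rewrite -(mulr0 (c%:R : R)); apply: cvgM; first exact: cvg_cst.
by rewrite -(cvg_shiftS (fun n => (n%:R^-1 : R))); exact: cvg_harmonic.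
Qed.

Lemma scaled_gcf_bound (s d : R) n m : 0 < s -> s < 1 -> 0 < d -> (0 < n)%N ->
  d * n%:R <= m.+1%:R ->
  n%:R `^ (1 - s) * gcf s m <= (Gamma s + 2) * d `^ (s - 1).
Proof.
move=> s0 s1 d0 n0 dm; have n0' : 0 < n%:R :> R by rewrite ltr0n.
have G0 : 0 <= Gamma s + 2 by rewrite addr_ge0 // ltW // Gamma_gt0.
apply: (@le_trans _ _ (n%:R `^ (1 - s) * ((Gamma s + 2) * m.+1%:R `^ (s - 1)))).
  by rewrite ler_wpM2l ?powR_ge0 ?gcf_bound.
rewrite mulrCA ler_wpM2l //.
apply: (@le_trans _ _ (n%:R `^ (1 - s) * (d * n%:R) `^ (s - 1))).
  rewrite ler_wpM2l ?powR_ge0 // ler_powR_le0 ?mulr_gt0 //.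
  by rewrite subr_le0 ltW.
rewrite powRM ?(ltW d0) // mulrCA -powRD ?(gt_eqF n0') ?implybT //.
by rewrite (_ : 1 - s + (s - 1) = 0) ?powRr0 ?mulr1 //; ring.
Qed.

End NatRatios.

Section TripleSum.
Context {R : realType}.
Notation mu := (@lebesgue_measure R).
Variables (b tau : R) (K : nat -> nat) (e : nat).
Hypotheses (b_gt0 : 0 < b) (b_lt1 : b < 1) (e_le1 : (e <= 1)%N).
Hypothesis tau_le : tau <= 1 / 2.
Hypothesis cvg_K : (K n)%:R / n%:R @[n --> \oo] --> tau.
Hypothesis K_le : forall n, (2 * K n <= n + 2)%N.

Let c := b * (1 - b).
Let d := (1 - b) * (1 - b).
Let q := b * b.

Let bC0 : 0 < 1 - b. Proof. by rewrite subr_gt0. Qed.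
Let bC1 : 1 - b < 1. Proof. by rewrite gtrBl. Qed.
Let c0 : 0 < c. Proof. exact: mulr_gt0. Qed.
Let d0 : 0 < d. Proof. exact: mulr_gt0. Qed.
Let q0 : 0 < q. Proof. exact: mulr_gt0. Qed.
Let c1 : c < 1. Proof. by rewrite /c mulr_ilt1 // ltW. Qed.
Let d1 : d < 1. Proof. by rewrite /d mulr_ilt1 // ltW. Qed.
Let q1 : q < 1. Proof. by rewrite /q mulr_ilt1 // ltW. Qed.

(** Each of the three sums is divided by its own power of n, with exponents c, q, c, and [gcf d] is
    multiplied by n^(1 - d). As 2 c + q + d = 1, these powers cancel in [half_sum]. *)
Definition inner_sum n w v : R :=
  (\sum_(u < w + e) gcf c u * (n%:R `^ (1 - d) * gcf d (n - w - v - u))) /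
  n%:R `^ c.

Definition middle_sum n w : R :=
  (\sum_(v < K n - w) gcf q v * inner_sum n w v) / n%:R `^ q.

Definition inner_integral w v : R :=
  \int[mu]_(u in `[0, w]) (u `^ (c - 1) / (1 - w - v - u) `^ (1 - d)).

Definition middle_integral w : R :=
  \int[mu]_(v in `[0, tau - w]) ((v `^ (1 - q))^-1 * inner_integral w v).

Definition outer_integral : R :=
  \int[mu]_(w in `[0, tau]) ((w `^ (1 - c))^-1 * middle_integral w).

Let inner_ge0 n w v : 0 <= inner_sum n w v.
Proof.
apply: divr_ge0; last exact: powR_ge0.
apply: sumr_ge0 => u _; apply: mulr_ge0; first exact: gcf_ge0.
by apply: mulr_ge0; [exact: powR_ge0|exact: gcf_ge0].
Qed.

Let middle_ge0 n w : 0 <= middle_sum n w.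
Proof.
apply: divr_ge0; last exact: powR_ge0.
by apply: sumr_ge0 => v _; apply: mulr_ge0 => //; exact: gcf_ge0.
Qed.

Lemma cvg_inner_sum (w v : R) (kw kv : nat -> nat) :
  0 < w -> 0 < v -> v + (w + w) < 1 ->
  (kw n)%:R / n%:R @[n --> \oo] --> w -> (kv n)%:R / n%:R @[n --> \oo] --> v ->
  inner_sum n (kw n) (kv n) @[n --> \oo] --> inner_integral w v.
Proof.
(* Half of the gap 1 - v - 2 w: eventually the index of [gcf d], plus one, is at least [de] n
   throughout the sum. *)
move=> w0 v0 vw1 cw cv; pose de := (1 - (v + (w + w))) / 2.
have de0 : 0 < de by rewrite divr_gt0 // subr_gt0.
apply: (@cvg_riemann_sum R c w ((Gamma d + 2) * de `^ (d - 1))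
  (fun n => kw n + e)%N (fun n k => n%:R `^ (1 - d) * gcf d (n - kw n - kv n - k))
  (fun u => (1 - w - v - u) `^ (d - 1))) => //.
- by move=> n k; apply: mulr_ge0; [exact: powR_ge0|exact: gcf_ge0].
- by rewrite -[w]addr0; apply: cvg_ratio_add => //; exact: cvg_ratio_cst.
- have cs := cvg_ratio_add cv (cvg_ratio_add cw cw).
  near=> n => k kn; have n0 : (0 < n)%N by near: n; exact: nbhs_infty_gt.
  have n0' : 0 < n%:R :> R by rewrite ltr0n.
  apply: scaled_gcf_bound => //.
  have : (kv n + (kw n + kw n))%N%:R / n%:R < 1 - de.
    by near: n; apply: (cvgr_lt _ cs); rewrite /de; lra.
  rewrite ltr_pdivrMr // mulrBl mul1r ltrBrDl => h.
  have h2 : (de * n%:R <= n%:R - (kv n + (kw n + kw n))%N%:R).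
    by rewrite lerBrDr; exact: ltW.
  apply: (le_trans h2); rewrite lerBlDr -natrD ler_nat.
  by move: kn e_le1; clear; lia.
- move=> x x0 xw; apply: cvg_gcf => //; first by lra.
  under eq_fun do rewrite -!subnDA.
  have -> : 1 - w - v - x = 1 - (w + (v + x)) by ring.
  apply: cvg_ratio_sub; [by lra|exact: cvg_ratio_id|].
  do 2!(apply: cvg_ratio_add => //).
  by apply: cvg_truncn_div; exact: ltW.
- by move=> x x0 xw; congr (_ * _); rewrite -powRN opprB.
Unshelve. all: by end_near. Qed.

(* Extending the sum to all u <= m = n - w - v only increases it; it is then a
   Vandermonde convolution of order m^(-b), and m >= n / 2 - 1. *)
Lemma inner_sum_bound : exists2 M, 0 <= M &
  forall n w v, (0 < n)%N -> (w < K n)%N -> (v < K n - w)%N -> inner_sum n w v <= M.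
Proof.
pose G := Gamma c * Gamma d / Gamma (1 - b).
have Gc := Gamma_gt0 c0 c1; have Gd := Gamma_gt0 d0 d1.
have Ga := Gamma_gt0 bC0 bC1.
have G0 : 0 <= G by exact: divr_ge0 (mulr_ge0 (ltW Gc) (ltW Gd)) (ltW Ga).
have hf0 : 0 < 2^-1 :> R by rewrite invr_gt0.
exists (G * ((Gamma (1 - b) + 2) * 2^-1 `^ (1 - b - 1))).
  apply: (mulr_ge0 G0); apply: mulr_ge0 (powR_ge0 _ _).
  exact: addr_ge0 (ltW Ga) (ler0n _ _).
move=> n w v n0 wK vK; have Kn := K_le n.
have n0' : 0 < n%:R :> R by rewrite ltr0n.
set m := (n - w - v)%N.
have -> : inner_sum n w v = n%:R `^ b *
    \sum_(u < w + e) gcf c u * gcf d (m - u).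
  rewrite /inner_sum (eq_bigr (fun u : 'I_(w + e) => n%:R `^ (1 - d) *
    (gcf c u * gcf d (m - u)))); last by move=> u _; rewrite mulrCA.
  rewrite -mulr_sumr mulrAC; congr (_ * _).
  by rewrite -powRB ?(gt_eqF n0') ?implybT //; congr (_ `^ _); rewrite /c /d; ring.
have wm : (w + e <= m.+1)%N.
  by rewrite /m; move: Kn wK vK e_le1; clear; lia.
have mn : 2^-1 * n%:R <= m.+1%:R :> R.
  rewrite mulrC ler_pdivrMr // -natrM ler_nat /m.
  by move: Kn wK vK e_le1; clear; lia.
have -> : G * ((Gamma (1 - b) + 2) * 2^-1 `^ (1 - b - 1)) =
   (Gamma (1 - b) + 2) * 2^-1 `^ (1 - b - 1) * G by rewrite mulrC.
apply: (@le_trans _ _ (n%:R `^ b * (G * gcf (1 - b) m))); last first.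
  rewrite mulrCA mulrC ler_wpM2r //.
  have -> : n%:R `^ b = n%:R `^ (1 - (1 - b)) by rewrite subKr.
  exact: scaled_gcf_bound.
rewrite ler_wpM2l ?powR_ge0 //.
have -> : G * gcf (1 - b) m = \sum_(u < m.+1) gcf c u * gcf d (m - u).
  rewrite (eq_bigr (fun u : 'I_m.+1 => Gamma c * Gamma d * (cf c u * cf d (m - u)))).
    rewrite -mulr_sumr cf_convolution /G /gcf.
    have -> : c + d = 1 - b by rewrite /c /d; ring.
    by rewrite [RHS]mulrC mulrA [in RHS]mulrC divfK // gt_eqF.
  by move=> u _; rewrite /gcf mulrACA.
rewrite (big_ord_widen m.+1 (fun u : nat => gcf c u * gcf d (m - u)) wm).
rewrite [leLHS]big_mkcond; apply: ler_sum => u _; case: ifP => _ //.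
by apply: mulr_ge0; exact: gcf_ge0.
Qed.

Lemma cvg_middle_sum (w : R) (kw : nat -> nat) : 0 < w -> w < tau ->
  (kw n)%:R / n%:R @[n --> \oo] --> w ->
  middle_sum n (kw n) @[n --> \oo] --> middle_integral w.
Proof.
move=> w0 wt cw; have [M M0 HM] := inner_sum_bound.
apply: (@cvg_riemann_sum R q (tau - w) M (fun n => K n - kw n)%N
  (fun n k => inner_sum n (kw n) k) (inner_integral w)) => //.
- exact: cvg_ratio_sub.
- near=> n => k kn; apply: HM => //; first by near: n; exact: nbhs_infty_gt.
  have := K_le n; move: kn; clear; lia.
- move=> v v0 vw; apply: cvg_inner_sum => //; last first.
    by apply: cvg_truncn_div; exact: ltW.
  (* Inside the domain v + 2 w < tau + w < 2 tau <= 1, even when tau = 1/2. *)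
  by move: wt tau_le vw; lra.
- by move=> x x0 xw; congr (_ * _); rewrite -powRN opprB.
Unshelve. all: by end_near. Qed.

(** The innermost sums are uniformly bounded, and the weights [gcf q] add up to order n^q. *)
Lemma middle_sum_bound : exists2 M, 0 <= M &
  forall n w, (0 < n)%N -> (w < K n)%N -> middle_sum n w <= M.
Proof.
have [M M0 HM] := inner_sum_bound; have [C C0 HC] := gcf_partial_sum q0 q1.
exists (C * M); first exact: mulr_ge0.
move=> n w n0 wK; have n0' : 0 < n%:R :> R by rewrite ltr0n.
have Kn := K_le n.
rewrite /middle_sum ler_pdivrMr ?powR_gt0 // mulrAC.
apply: le_trans (ler_wpM2r M0 (HC n n0)).
rewrite mulr_suml.
have Kwn : (K n - w <= n.+1)%N by move: Kn; clear; lia.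
rewrite (big_ord_widen n.+1 (fun v : nat => gcf q v * inner_sum n w v) Kwn).
rewrite [leLHS]big_mkcond; apply: ler_sum => v _; case: ifP => vK.
  by rewrite ler_wpM2l ?HM // gcf_ge0.
by apply: mulr_ge0 => //; exact: gcf_ge0.
Qed.

Lemma cvg_outer_sum :
  (\sum_(w < K n) gcf c w * middle_sum n w) / n%:R `^ c @[n --> \oo] -->
  outer_integral.
Proof.
have [M M0 HM] := middle_sum_bound.
apply: (@cvg_riemann_sum R c tau M K middle_sum middle_integral) => //.
- by near=> n => k kn; apply: HM => //; near: n; exact: nbhs_infty_gt.
- move=> w w0 wt; apply: cvg_middle_sum => //.
  by apply: cvg_truncn_div; exact: ltW.
- by move=> x x0 xw; congr (_ * _); rewrite -powRN opprB.
Unshelve. all: by end_near. Qed.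

Lemma cvg_half_sum : half_sum b n (K n) e @[n --> \oo] -->
  outer_integral / (Gamma d * Gamma q * Gamma c ^+ 2).
Proof.
have Gc := Gamma_gt0 c0 c1; have Gd := Gamma_gt0 d0 d1.
have Gq := Gamma_gt0 q0 q1.
have : (\sum_(w < K n) gcf c w * middle_sum n w) / n%:R `^ c /
    (Gamma d * Gamma q * Gamma c ^+ 2) @[n --> \oo] -->
    outer_integral / (Gamma d * Gamma q * Gamma c ^+ 2).
  by apply: cvgM; [exact: cvg_outer_sum|exact: cvg_cst].
apply: cvg_trans; apply: near_eq_cvg; near=> n.
have n0 : 0 < n%:R :> R by rewrite ltr0n; near: n; exact: nbhs_infty_gt.
have pE : n%:R `^ (1 - d) = n%:R `^ c * n%:R `^ q * n%:R `^ c.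
  rewrite -!powRD ?(gt_eqF n0) ?implybT //; congr (_ `^ _).
  by rewrite /c /d /q; ring.
have pc : n%:R `^ c != 0 by rewrite gt_eqF ?powR_gt0.
have pq : n%:R `^ q != 0 by rewrite gt_eqF ?powR_gt0.
rewrite /half_sum -/c -/d -/q 2!mulr_suml; apply: eq_bigr => w _.
have mE : middle_sum n w = n%:R `^ c * (Gamma d * Gamma q * Gamma c) *
    \sum_(v < K n - w) cf q v * \sum_(u < w + e) cf c u * cf d (n - w - v - u).
  rewrite /middle_sum mulr_suml mulr_sumr; apply: eq_bigr => v _.
  rewrite /inner_sum !(mulr_suml, mulr_sumr); apply: eq_bigr => u _.
  rewrite /gcf pE; move: pc pq.
  move: (_ `^ c) (_ `^ q) (Gamma c) (Gamma d) (Gamma q) => pc pq x y z pc0 pq0.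
  move: (cf q v) (cf c u) (cf d _) => x1 x2 x3.
  by field; rewrite pc0 pq0.
rewrite mE /gcf; move: pc (gt_eqF Gc) (gt_eqF Gd) (gt_eqF Gq).
move: (_ `^ c) (Gamma c) (Gamma d) (Gamma q) (cf c w) (\sum_(v < _) _).
move=> pc x y z x1 x2 pc0 x0 y0 z0.
by field; rewrite pc0 x0 y0 z0.
Unshelve. all: by end_near. Qed.

End TripleSum.

(** The limits for e = 0 and e = 1 coincide, the diagonal u = w being negligible; this is the factor
    2 in [Ifun]. *)
Lemma cvg_pair_cdf (R : realType) (b tau : R) (K : nat -> nat) :
  0 < b -> b < 1 -> tau <= 1 / 2 ->
  (K n)%:R / n%:R @[n --> \oo] --> tau -> (forall n, (2 * K n <= n + 2)%N) ->
  pair_cdf b n (K n) @[n --> \oo] --> Ifun tau (1 - b).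
Proof.
move=> b0 b1 t1 cK K_le.
under eq_fun do rewrite pair_cdf_half_sum //.
have -> : Ifun tau (1 - b) =
  outer_integral b tau / (Gamma ((1 - b) * (1 - b)) * Gamma (b * b) *
    Gamma (b * (1 - b)) ^+ 2) +
  outer_integral b tau / (Gamma ((1 - b) * (1 - b)) * Gamma (b * b) *
    Gamma (b * (1 - b)) ^+ 2).
  rewrite /Ifun /= subKr !expr2 [(1 - b) * b]mulrC.
  rewrite /outer_integral /middle_integral /inner_integral; ring.
by apply: cvgD; exact: cvg_half_sum.
Qed.

(** * Limit of the size of one divisor *)

Section BetaLimit.
Context {R : realType}.
Notation mu := (@lebesgue_measure R).
Implicit Types (b tau : R).

(** The exponent 1 - (1 - b) is left unsimplified to match the integrand of [beta_df] at (b, 1 -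
    b). *)
Definition beta_kernel b (v : R) := (v `^ (1 - b) * (1 - v) `^ (1 - (1 - b)))^-1.

Lemma beta_kernel_ge0 b v : 0 <= beta_kernel b v.
Proof. by rewrite invr_ge0 mulr_ge0 ?powR_ge0. Qed.

Lemma measurable_beta_kernel b (D : set (measurableTypeR R)) :
  measurable_fun D (beta_kernel b).
Proof.
apply: measurable_funTS.
have -> : beta_kernel b =
    (fun v => v `^ (- (1 - b)) * (1 - v) `^ (- (1 - (1 - b)))).
  by apply/funext => v; rewrite /beta_kernel invfM -!powRN.
apply: measurable_funM; first exact: measurable_powR.
apply: (measurableT_comp (measurable_powR _)).
by apply: measurable_funB => //; exact: measurable_id.
Qed.

Section Limit.
Variables (b tau : R) (K : nat -> nat).
Hypotheses (b_gt0 : 0 < b) (b_lt1 : b < 1) (tau_lt1 : tau < 1).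
Hypothesis cvg_K : (K n)%:R / n%:R @[n --> \oo] --> tau.

Let bC0 : 0 < 1 - b. Proof. by rewrite subr_gt0. Qed.
Let bC1 : 1 - b < 1. Proof. by rewrite gtrBl. Qed.

(** Half of the gap to 1: as tau < 1, the index n - k stays above a multiple of n, away from the
    singularity at v = 1. *)
Let de := (1 - tau) / 2.
Let de0 : 0 < de. Proof. by rewrite divr_gt0 // subr_gt0. Qed.

Let M := (Gamma (1 - b) + 2) * de `^ (1 - b - 1).

Let h n k := n%:R `^ (1 - (1 - b)) * gcf (1 - b) (n - k).

Let h_ge0 n k : 0 <= h n k.
Proof. by apply: mulr_ge0; [exact: powR_ge0|exact: gcf_ge0]. Qed.

Let h_le : \forall n \near \oo, forall k, (k < K n)%N -> h n k <= M.
Proof.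
near=> n => k kK; have n0 : (0 < n)%N by near: n; exact: nbhs_infty_gt.
have n0' : 0 < n%:R :> R by rewrite ltr0n.
apply: scaled_gcf_bound => //.
have : (K n)%:R / n%:R < 1 - de.
  by near: n; apply: (cvgr_lt _ cvg_K); move: tau_lt1; rewrite /de; lra.
rewrite ltr_pdivrMr // mulrBl mul1r ltrBrDl => lt.
have le : de * n%:R <= n%:R - (K n)%:R by rewrite lerBrDr; exact: ltW.
apply: (le_trans le); rewrite lerBlDr -natrD ler_nat.
by move: kK; clear; lia.
Unshelve. all: by end_near. Qed.

Let cvg_h x : 0 < x -> x < tau ->
  h n (Num.truncn (n%:R * x)) @[n --> \oo] --> (1 - x) `^ (1 - b - 1).
Proof.
move=> x0 xt; have x1 : x < 1 by apply: lt_trans tau_lt1.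
apply: cvg_gcf => //; first by lra.
apply: cvg_ratio_sub; [by lra|exact: cvg_ratio_id|].
by apply: cvg_truncn_div; exact: ltW.
Qed.

Let kernelE x : 0 < x -> x < tau ->
  beta_kernel b x = x `^ (b - 1) * (1 - x) `^ (1 - b - 1).
Proof.
move=> x0 xt; rewrite /beta_kernel invfM -!powRN; congr (_ `^ _ * _ `^ _); ring.
Qed.

Lemma integrable_beta_kernel :
  mu.-integrable `]0, tau[ (EFin \o beta_kernel b).
Proof.
exact: (riemann_sum_integrable b_gt0 b_lt1 h_ge0 cvg_K h_le cvg_h kernelE).
Qed.

Lemma cvg_size_cdf : size_cdf b n (K n) @[n --> \oo] --> beta_df tau b (1 - b).
Proof.
have Gb := Gamma_gt0 b_gt0 b_lt1; have Ga := Gamma_gt0 bC0 bC1.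
rewrite /beta_df subrKC Gamma1 mul1r mulrC.
have : (\sum_(k < K n) gcf b k * h n k) / n%:R `^ b / (Gamma b * Gamma (1 - b))
    @[n --> \oo] --> (\int[mu]_(v in `[0%R, tau]) beta_kernel b v) /
    (Gamma b * Gamma (1 - b)).
  apply: cvgM; last exact: cvg_cst.
  exact: (cvg_riemann_sum b_gt0 b_lt1 h_ge0 cvg_K h_le cvg_h kernelE).
apply: cvg_trans; apply: near_eq_cvg; near=> n.
have n0 : 0 < n%:R :> R by rewrite ltr0n; near: n; exact: nbhs_infty_gt.
rewrite /size_cdf 2!mulr_suml; apply: eq_bigr => k _.
rewrite /h /gcf subKr.
have p0 : n%:R `^ b != 0 by rewrite gt_eqF ?powR_gt0.
move: p0 (gt_eqF Ga) (gt_eqF Gb); move: (_ `^ b) (Gamma b) (Gamma (1 - b)).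
by move=> p x y p0 y0 x0; field; rewrite p0 x0 y0.
Unshelve. all: by end_near. Qed.

End Limit.

(** The upper part of the full convolution is read backwards, k becoming n - k. *)
Lemma size_cdf_compl b n K : (K <= n.+1)%N ->
  size_cdf b n K + size_cdf (1 - b) n (n.+1 - K) = 1.
Proof.
move=> Kn; rewrite -[RHS](size_cdf_total b n) /size_cdf subKr.
have nE N (G : nat -> R) : N = n.+1 -> \sum_(k < n.+1) G k = \sum_(k < N) G k.
  by move=> ->.
rewrite (nE _ (fun k => cf b k * cf (1 - b) (n - k)) (subnKC Kn)).
rewrite big_split_ord /=; congr (_ + _).
rewrite (reindex_inj rev_ord_inj) /=; apply: eq_bigr => k _.
have kK : (k < n.+1 - K)%N by [].
rewrite mulrC; congr (cf _ _ * cf _ _); lia.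
Qed.

Lemma cvg_trunc_ratio (x : R) : 0 <= x ->
  (Num.truncn (x * n%:R)).+1%:R / n%:R @[n --> \oo] --> x.
Proof.
move=> x0; rewrite -[X in _ --> X]addr0.
under eq_fun do rewrite -addn1 [x * _]mulrC.
by apply: cvg_ratio_add; [exact: cvg_truncn_div|exact: cvg_ratio_cst].
Qed.

Lemma cvg_trunc_ratioC (x : R) : x <= 1 -> 0 <= x ->
  (n.+1 - (Num.truncn (x * n%:R)).+1)%N%:R / n%:R @[n --> \oo] --> 1 - x.
Proof.
move=> x1 x0; have cx := cvg_truncn_div x0.
have : n%:R / n%:R - (Num.truncn (n%:R * x))%:R / n%:R @[n --> \oo] --> 1 - x.
  by apply: cvgB => //; exact: cvg_ratio_id.
apply: cvg_trans; apply: near_eq_cvg; near=> n.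
rewrite [x * _]mulrC subSS natrB ?mulrBl // -(ler_nat R) mulrC.
apply: (@le_trans _ _ (x * n%:R)); first by rewrite truncn_le mulr_ge0.
by rewrite ler_piMl.
Unshelve. all: by end_near. Qed.

(** The limit of [size_cdf_compl], in place of a substitution v -> 1 - v in the integral. *)
Lemma beta_df_compl b (x : R) : 0 < b -> b < 1 -> 0 < x -> x < 1 ->
  beta_df x b (1 - b) + beta_df (1 - x) (1 - b) b = 1.
Proof.
move=> b0 b1 x0 x1; have x0' := ltW x0.
have c1 := cvg_size_cdf b0 b1 x1 (cvg_trunc_ratio x0').
have bC0 : 0 < 1 - b by rewrite subr_gt0.
have bC1 : 1 - b < 1 by rewrite gtrBl.
have xC1 : 1 - x < 1 by rewrite gtrBl.
have c2 := cvg_size_cdf bC0 bC1 xC1 (cvg_trunc_ratioC (ltW x1) x0').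
rewrite subKr in c2.
have C : size_cdf b n (Num.truncn (x * n%:R)).+1 +
    size_cdf (1 - b) n (n.+1 - (Num.truncn (x * n%:R)).+1)%N @[n --> \oo] -->
    beta_df x b (1 - b) + beta_df (1 - x) (1 - b) b.
  exact: (cvgD c1 c2).
rewrite -(cvg_lim _ C) //; under eq_fun => n.
  rewrite size_cdf_compl; first over.
  rewrite ltnS -(ler_nat R); apply: (@le_trans _ _ (x * n%:R)).
    by rewrite truncn_le mulr_ge0.
  by rewrite ler_piMl // ltW.
exact: lim_cst.
Qed.

(* The normalisation of the beta law comes for free from that of the discrete laws,
   by letting x -> 1 in beta_df_compl. *)
Lemma beta_df1 b : 0 < b -> b < 1 -> beta_df 1 b (1 - b) = 1.
Proof.
move=> b0 b1.
have bC0 : 0 < 1 - b by rewrite subr_gt0.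
have bC1 : 1 - b < 1 by rewrite gtrBl.
have Gb := Gamma_gt0 b0 b1; have Ga := Gamma_gt0 bC0 bC1.
(* Continuity at 0 of the integral of an integrable function; 1/2 serves as some point inside ]0,
   1[. *)
have Bto0 : beta_df x (1 - b) b @[x --> (0:R)^'+] --> (0 : R).
  have h1 : (2^-1 : R) < 1 by rewrite invf_lt1 ?ltr1n.
  have h0 : 0 < (2^-1 : R) by rewrite invr_gt0.
  have cK := cvg_trunc_ratio (ltW h0).
  have I0 := integrable_beta_kernel bC0 bC1 h1 cK.
  have I1 : mu.-integrable (`[0, 2^-1] : set R) (EFin \o beta_kernel (1 - b)).
    apply/integrableP; split.
      by apply/measurable_EFinP; exact: measurable_beta_kernel.
    rewrite integral_itv_bndoo; first by case/integrableP : I0.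
    apply/measurable_EFinP; apply: measurableT_comp => //.
    exact: measurable_beta_kernel.
  have L := parameterized_integral_cvg_left h0 I1.
  have -> : (fun x => beta_df x (1 - b) b) = (fun x =>
      (Gamma (1 - b) * Gamma b)^-1 * parameterized_integral mu 0 x (beta_kernel (1 - b))).
    apply/funext => x; rewrite /beta_df [1 - b + b]subrK Gamma1; congr *%R.
      by rewrite [LHS]mul1r.
    by apply: eq_Rintegral => v _; rewrite /beta_kernel subKr.
  rewrite -[X in _ --> X](mulr0 (Gamma (1 - b) * Gamma b)^-1).
  apply: cvgM; first exact: cvg_cst.
  exact: cvg_at_right_filter L.
pose u (n : nat) : R := n.+2%:R^-1.
have u0 n : 0 < u n by rewrite invr_gt0.
have u1 n : u n < 1 by rewrite invf_lt1 ?ltr1n // ltr0n.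
have cu : u n @[n --> \oo] --> (0 : R).
  by rewrite (cvg_shiftS (fun i => (i.+1%:R^-1 : R))); exact: cvg_harmonic.
have cB : 1 - beta_df (u n) (1 - b) b @[n --> \oo] --> (1 : R).
  rewrite -[X in _ --> X]subr0; apply: cvgB; first exact: cvg_cst.
  by move/cvg_at_rightP : Bto0; apply; split.
have BE n : beta_df (1 - u n) b (1 - b) = 1 - beta_df (u n) (1 - b) b.
  have := @beta_df_compl b (1 - u n) b0 b1; rewrite subr_gt0 u1 gtrBl u0 subKr.
  by move=> /(_ isT isT) h; apply/esym/eqP; rewrite subr_eq; apply/eqP/esym.
pose G := Gamma b * Gamma (1 - b).
have G0 : 0 < G by exact: mulr_gt0 Gb Ga.
have IE n : (\int[mu]_(v in `[0%R, (1 - u n)%R]) (beta_kernel b v)%:E =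
    (G * (1 - beta_df (u n) (1 - b) b))%:E)%E.
  have h1 : 1 - u n < 1 by rewrite gtrBl.
  have cK := @cvg_trunc_ratio (1 - u n); rewrite subr_ge0 ltW // in cK.
  have I0 := integrable_beta_kernel b0 b1 h1 (cK isT).
  rewrite -BE /beta_df subrKC Gamma1 mul1r mulrA divff ?gt_eqF // mul1r.
  rewrite /Rintegral fineK //.
  rewrite integral_itv_bndoo; first exact: (integrable_fin_num _ I0).
  by apply/measurable_EFinP; exact: measurable_beta_kernel.
have C1 : (\int[mu]_(v in `[0%R, (1 - u n)%R]) (beta_kernel b v)%:E)%E
    @[n --> \oo] --> G%:E.
  under eq_fun do rewrite IE.
  apply: cvg_EFin; first exact: nearW.
  by rewrite -[X in _ --> X]mulr1; apply: cvgM; first exact: cvg_cst.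
(* Monotone convergence on the growing intervals [0, 1 - u n] does not presuppose integrability up
   to 1. *)
have C2 : (\int[mu]_(v in `[0%R, (1 - u n)%R]) (beta_kernel b v)%:E)%E
    @[n --> \oo] --> (\int[mu]_(v in `[0%R, 1%R]) (beta_kernel b v)%:E)%E.
  have -> : (\int[mu]_(v in `[0%R, 1%R]) (beta_kernel b v)%:E =
      \int[mu]_(v in \bigcup_n (`[0%R, (1 - u n)%R] : set R)) (beta_kernel b v)%:E)%E.
    rewrite -integral_itv_bndo_bndc; last first.
      by apply/measurable_EFinP; exact: measurable_beta_kernel.
    congr (integral _ _ _); apply/seteqP; split => [x|x [n _]] /=; rewrite !in_itv/=.
      move=> /andP[x0 x1]; pose k := Num.truncn (1 - x)^-1.
      have x1' : 0 < 1 - x by rewrite subr_gt0.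
      exists k => //=; rewrite in_itv/= x0 /= lerBrDr -lerBrDl /u.
      rewrite -[leRHS]invrK lef_pV2 ?posrE ?invr_gt0 //.
      have : (1 - x)^-1 < k.+1%:R by rewrite -truncn_lt_nat // invr_ge0 ltW.
      by move=> /ltW /le_trans; apply; rewrite ler_nat.
    move=> /andP[-> /= /le_lt_trans]; apply; by rewrite gtrBl.
  apply: ge0_nondecreasing_set_cvg_integral => //.
  - move=> i j ij; rewrite subsetEset; apply: subset_itvl; rewrite bnd_simp.
    by rewrite lerB // lef_pV2 ?posrE // ler_nat !ltnS.
  - by move=> i; apply/measurable_EFinP; exact: measurable_beta_kernel.
  - by move=> i x _; rewrite lee_fin beta_kernel_ge0.
have E1 : (\int[mu]_(v in `[0%R, 1%R]) (beta_kernel b v)%:E = G%:E)%E.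
  by rewrite -(cvg_lim _ C2) // (cvg_lim _ C1).
rewrite /beta_df subrKC Gamma1 mul1r /Rintegral -/(beta_kernel b _).
by rewrite E1 /= mulVf // gt_eqF.
Qed.

End BetaLimit.

(** * The limit of the second moment *)

Local Open Scope ring_scope.

Theorem corollary2 (R : realType) (vtheta theta : R)
  (vtheta_gt0 : 0 < vtheta) (thetaE : theta = vtheta / (1 + vtheta))
  (t : R) (t_ge0 : 0 <= t) (t_le1 : t <= 1) :
  (fun n : nat =>
     perm_expectation (fun s : 'S_n => divisor_process vtheta s t ^+ 2))
    @ \oo -->
  (if t <= 1 / 2 then Ifun t (1 - theta)
   else Ifun (1 - t) theta + 2 * beta_df t theta (1 - theta) - 1).
Proof.
have v1 : 0 < 1 + vtheta by rewrite addr_gt0.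
have b0 : 0 < theta by rewrite thetaE divr_gt0.
have b1 : theta < 1 by rewrite thetaE ltr_pdivrMr // mul1r ltrDr.
(* With this choice k < K n means exactly k <= t n. *)
pose K n := (Num.truncn (t * n%:R)).+1.
have cdfE n : perm_expectation (fun s : 'S_n => divisor_process vtheta s t ^+ 2) =
    pair_cdf theta n (K n).
  rewrite thetaE; apply: perm_expectation_sqr => // k.
  by rewrite /K ltnS truncn_ge_nat // mulr_ge0.
under eq_fun do rewrite cdfE.
have cK : (K n)%:R / n%:R @[n --> \oo] --> t by exact: cvg_trunc_ratio.
have tn n : (Num.truncn (t * n%:R))%:R <= t * n%:R by rewrite truncn_le mulr_ge0.
have Kn n : (K n <= n.+1)%N.
  by rewrite /K ltnS -(ler_nat R); apply: (le_trans (tn n)); rewrite ler_piMl.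
case: ifPn => [t2|]; [|rewrite -ltNge => t2].
  apply: cvg_pair_cdf => // n; rewrite /K.
  have : (2 * Num.truncn (t * n%:R))%N%:R <= n%:R :> R.
    rewrite natrM; apply: (le_trans (ler_wpM2l _ (tn n))) => //.
    rewrite mulrA ler_piMl // mulrC -ler_pdivlMr //.
  by rewrite ler_nat; move: (Num.truncn _) => m; clear; lia.
(* The complementary bound n + 1 - K n corresponds to the parameter 1 - t < 1/2, within reach of
   [cvg_pair_cdf]. *)
under eq_fun do rewrite pair_cdf_compl ?Kn // addrC addrA.
have bC0 : 0 < 1 - theta by rewrite subr_gt0.
have bC1 : 1 - theta < 1 by rewrite gtrBl.
apply: cvgB; last exact: cvg_cst.
apply: cvgD.
  rewrite -[X in Ifun _ X](subKr 1); apply: cvg_pair_cdf => //.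
  - by move: t2; lra.
  - exact: cvg_trunc_ratioC.
  (* The condition 2 (n + 1 - K n) <= n + 2 amounts to n <= 2 K n. *)
  - move=> n; have : n%:R <= (2 * K n)%N%:R :> R.
      apply: ltW; rewrite natrM.
      have : t * n%:R < (K n)%:R by rewrite -truncn_lt_nat ?mulr_ge0.
      have : n%:R <= 2 * (t * n%:R) :> R.
        rewrite mulrA ler_peMl //; move: t2; lra.
      by move=> h1 h2; apply: (le_lt_trans h1); rewrite ltr_pM2l.
    by rewrite ler_nat; have := Kn n; move: (K n) => m; clear; lia.
apply: cvgM; first exact: cvg_cst.
(* [cvg_size_cdf] stops short of t = 1; there K n = n + 1, so the discrete distribution function is
   identically 1. *)
have [t1|t1] := ltP t 1; first exact: cvg_size_cdf.
have tE : t = 1 by apply/eqP; rewrite eq_le t_le1.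
rewrite tE beta_df1 //.
rewrite (_ : (fun n => size_cdf theta n (K n)) = cst 1); first exact: cvg_cst.
apply/funext => n; rewrite /K tE mul1r.
have -> : Num.truncn (n%:R : R) = n by exact: natrK.
exact: size_cdf_total.
Qed.
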